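(* Let $q\ge5$ be a prime power, $n,N$ divisors of $q-1$, and let $f,F\in\mathbb{F}_q[x]$ be non-constant square-free polynomials with $f/F$ not constant; let $D+1\ge2$ be the number of distinct roots of $f\cdot F$ in its splitting field over $\mathbb{F}_q$. Write $((q-1)/n)^*=k_np_1\cdots p_u$ and $((q-1)/N)^*=k_Nl_1\cdots l_v$, where $p_1,\dots,p_u$ are distinct primes not dividing $k_n$ and $l_1,\dots,l_v$ are distinct primes not dividing $k_N$. Set $\delta=1-\sum_{i=1}^u1/p_i-\sum_{i=1}^v1/l_i$ and assume $\delta>0$. If $$q^{1/2}>D\,n\,N\,W(k_n)W(k_N)\left(\frac{u+v-1}{\delta}+2\right),$$ then there exists $\theta\in\mathbb{F}_q$ such that $f(\theta)$ is $n$-primitive and $F(\theta)$ is $N$-primitive.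
   Context: For a positive integer $A$, $A^*$ denotes the product of the distinct primes dividing $A$. For a divisor $n$ of $q-1$, an element of $\mathbb{F}_q$ is $n$-primitive if it is nonzero and has multiplicative order $(q-1)/n$. $W(a)$ is the number of square-free divisors of $a$. *)

(* Defs.v *)
From HB Require Import structures.
From mathcomp Require Import all_boot all_order all_algebra all_fingroup all_field.
Set Implicit Arguments. Unset Strict Implicit. Unset Printing Implicit Defensive.
Import GRing.Theory Num.Theory.
Local Open Scope ring_scope.

Definition nat_rad (A : nat) : nat := (\prod_(p <- primes A) p)%N.

Definition sqfree_nat (d : nat) : bool :=
  (0 < d)%N && all (fun p => ~~ dvdn (p * p) d) (primes d).

Definition W (a : nat) : nat := count sqfree_nat (divisors a).

Definition sqfree_poly (K : fieldType) (p : {poly K}) : Prop :=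
  p != 0 /\ forall g : {poly K}, g * g %| p -> (size g <= 1)%N.

Definition n_primitive (K : finFieldType) (n : nat) (x : K) : Prop :=
  x != 0 /\ ((divn #|K|.-1 n).-primitive_root x).

(* Main.v *)
(**
Following the usual character-sum approach, everything rests on the bound
[|sum_x chi1(f x) chi2(F x)| <= D sqrt q] for characters that are not both trivial, which is proved
in the manner of Stepanov and Bombieri without leaving [K[X]]. Write the summand as
[theta(f^A F^B)] with [theta] a faithful character of [K^*], and extend it to the multiplicative
function [psi(h) = theta(Res(h,f)^A Res(h,F)^B)] on monic polynomials, the resultants being
determinants of [h] at companion matrices. Since [psi(h)] depends only on [h] modulo
[M = lcm(f, F)], of degree at most [D + 1], the L-function [sum_h psi(h) T^deg(h)] is a polynomial
of degree at most [D], and its logarithmic derivative (the identity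
[m A_m = sum_k S_k A_(m-k)], a count of prime powers dividing [h]) shows that
[S_k = sum_(deg P | k) deg P psi(P)^(k / deg P)] is minus the sum of the [k]-th powers of at most
[D] inverse roots. A bound [S_k = O(q^(k/2))] for all large even [k] therefore forces every inverse
root to have modulus at most [sqrt q], and [S_1] is the sum to be bounded.

For that bound let [Q = q^k], [d c = Q - 1] and [g = f^a F^b], with [d] the order of the character.
One constructs [R = sum_(i,j) k_ij X^(iQ) g^(cj)] vanishing to a high order along every irreducible
[P] with [deg P | k] and [g^c = z] modulo [P]. It is non-zero because a relation
[sum_j h_j(X, X^Q) g^(cj) = 0] would make [g(Y)/g(X)] raised to some power [0 < e < d] a [d]-th power
in [K(X, Y)], contradicting the multiplicities of the roots of [g].

The indicator of the elements that are [n]-primitive with respect to a set [s] of primes is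
[kap] times a combination of characters with total weight at most [n 2^|s|] in which the trivial
character has coefficient one. Adding a prime [p] multiplies [kap] by [1 - 1/p] and only introduces
non-trivial characters, so the sieve inequality
[N(all) >= sum_p N(p) + sum_l N(l) - (u + v - 1) N] gives the result.
*)

Require Import Defs.
From HB Require Import structures.
From mathcomp Require Import all_boot all_order all_algebra all_fingroup all_field.
From mathcomp Require Import cyclic zify ring lra.
Set Implicit Arguments. Unset Strict Implicit. Unset Printing Implicit Defensive.
Import Order.TTheory GRing.Theory Num.Theory.
Local Open Scope ring_scope.

(** * Linear independence of the powers of [g^c] over polynomials in [X] and [X^Q] *)

Section InnerDegree.
Variables (k : nzRingType) (w : nat).

(** The slope [w] lets the inner degree grow with the power of the outer variable: [w = 0] serves
    for polynomials in [X] and [X^Q], [w = G] for Taylor expansions in the direction of [g]. *)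
Definition inner_deg_le (b : nat) (h : {poly {poly k}}) : Prop :=
  forall i, (size (h`_i)%R <= (b + w * i).+1)%N.

Lemma inner_deg_leW b c h : (b <= c)%N -> inner_deg_le b h -> inner_deg_le c h.
Proof. by move=> bc hb i; apply: leq_trans (hb i) _; rewrite ltnS leq_add2r. Qed.

Lemma inner_deg_le0 b : inner_deg_le b 0.
Proof. by move=> i; rewrite coef0 size_poly0. Qed.

Lemma inner_deg_leD b h1 h2 :
  inner_deg_le b h1 -> inner_deg_le b h2 -> inner_deg_le b (h1 + h2).
Proof.
move=> H1 H2 i; rewrite coefD (leq_trans (size_polyD _ _)) // geq_max.
by rewrite H1 H2.
Qed.

Lemma inner_deg_leN b h : inner_deg_le b h -> inner_deg_le b (- h).
Proof. by move=> H i; rewrite coefN size_polyN. Qed.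

Lemma inner_deg_le_sum (I : Type) (r : seq I) (P : pred I) b h :
  (forall i, P i -> inner_deg_le b (h i)) -> inner_deg_le b (\sum_(i <- r | P i) h i).
Proof.
move=> H; elim/big_rec: _ => [|i x Pi IH]; first exact: inner_deg_le0.
by apply: inner_deg_leD => //; apply: H.
Qed.

Lemma inner_deg_leM b1 b2 h1 h2 :
  inner_deg_le b1 h1 -> inner_deg_le b2 h2 -> inner_deg_le (b1 + b2) (h1 * h2).
Proof.
move=> H1 H2 i; rewrite coefM (leq_trans (size_sum _ _ _)) //.
apply/bigmax_leqP => j _; rewrite (leq_trans (size_polyMleq _ _)) //.
have := H1 j; have := H2 (i - j)%N; have := ltn_ord j.
move: (size _) (size _) => s1 s2; rewrite ltnS => ji.
have -> : (w * i = w * j + w * (i - j))%N by rewrite -mulnDr subnKC.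
lia.
Qed.

Lemma inner_deg_leC b (p : {poly k}) : (size p <= b.+1)%N -> inner_deg_le b p%:P.
Proof.
move=> sp i; rewrite coefC; case: eqP => _; last by rewrite size_poly0.
by rewrite (leq_trans sp) // ltnS leq_addr.
Qed.

Lemma inner_deg_le1 : inner_deg_le 0 1.
Proof. by apply: inner_deg_leC; rewrite size_poly1. Qed.

Lemma inner_deg_le_exp b h n : inner_deg_le b h -> inner_deg_le (n * b) (h ^+ n).
Proof.
move=> H; elim: n => [|n IH]; first exact: inner_deg_le1.
by rewrite exprS mulSn; apply: inner_deg_leM.
Qed.

Lemma inner_deg_le_prod (I : Type) (r : seq I) b h :
  (forall i, inner_deg_le (b i) (h i)) ->
  inner_deg_le (\sum_(i <- r) b i) (\prod_(i <- r) h i).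
Proof.
move=> H; elim: r => [|i r IH]; first by rewrite !big_nil; apply: inner_deg_le1.
by rewrite !big_cons; apply: inner_deg_leM.
Qed.

End InnerDegree.

Lemma inner_deg_le_det (k : comNzRingType) w n (M : 'M[{poly {poly k}}]_n) (b : 'I_n -> nat) :
  (forall i j, inner_deg_le w (b i) (M i j)) ->
  inner_deg_le w (\sum_i b i) (\det M).
Proof.
move=> H; apply: inner_deg_le_sum => s _.
have H1 : inner_deg_le w (\sum_i b i) (\prod_i M i (s i)).
  by apply: inner_deg_le_prod.
rewrite -signr_odd; case: (odd _); rewrite ?expr1 ?expr0 ?mul1r //.
by rewrite mulN1r; apply: inner_deg_leN.
Qed.

(* Base-[Q] expansion: the powers of [X^Q] do not interact with coefficients of degree below [Q]. *)
Lemma horner_Xn_eq0 (k : idomainType) (h : {poly {poly k}}) (Q b : nat) :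
  inner_deg_le 0 b h -> (b < Q)%N -> h.['X^Q] = 0 -> h = 0.
Proof.
move=> hb bQ; elim/poly_ind: h hb => [//|h c IH] hb.
rewrite hornerMXaddC => E.
have sc : (size c <= Q)%N.
  have := hb 0%N; rewrite coefD coefMX coefC /= add0r mul0n addn0 => /leq_trans.
  by apply.
have h0 : h.['X^Q] = 0.
  apply/eqP; apply: contraTT sc => nz; rewrite -ltnNge.
  have -> : c = - (h.['X^Q] * 'X^Q) by apply/eqP; rewrite -addr_eq0 addrC E.
  by rewrite size_polyN size_mulXn // -addn1 leq_add2l lt0n size_poly_eq0.
have -> : h = 0.
  apply: IH h0 => i; have := hb i.+1.
  by rewrite coefD coefMX coefC /= addr0 !mul0n.
have -> : c = 0 by move: E; rewrite h0 mul0r add0r.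
by rewrite mul0r add0r.
Qed.

(** * Companion matrices, root multiplicities and fractions *)

Lemma companion_ex (R : comNzRingType) (p : {poly R}) n :
  p \is monic -> size p = n.+2 -> exists C : 'M[R]_n.+1, char_poly C = p.
Proof.
move=> pm sp; have := companionmxK pm; move: (companionmx p).
by rewrite sp /= => C <-; exists C.
Qed.

Lemma det_exp (R : comNzRingType) n (A : 'M[R]_n.+1) m : \det (A ^+ m) = \det A ^+ m.
Proof. by elim: m => [|m IH]; rewrite ?det1 // !exprS det_mulmx IH. Qed.

(* The determinant of the companion matrix of [p] is a product of [deg p] roots of
   [X^d - w], up to sign. *)
Lemma dvdp_XnsubC_pow (E : fieldType) (p : {poly E}) (w : E) d :
  (1 < size p)%N -> p %| 'X^d - w%:P -> exists z : E, z ^+ d = w ^+ (size p).-1.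
Proof.
move=> sp pd.
have p0 : p != 0 by rewrite -size_poly_gt0 ltnW.
set p1 := (lead_coef p)^-1 *: p.
have lc0 : (lead_coef p)^-1 != 0 by rewrite invr_eq0 lead_coef_eq0.
have p1m : p1 \is monic by rewrite monicE lead_coefZ mulVf // lead_coef_eq0.
have sp1 : size p1 = size p by rewrite size_scale.
have p1d : p1 %| 'X^d - w%:P by rewrite dvdpZl.
case En : (size p) sp => [|[|n]] // _.
have [C CE] := companion_ex p1m (etrans sp1 En).
have /dvdpP[r Er] := p1d.
have : horner_mx C ('X^d - w%:P) = 0.
  by rewrite Er rmorphM /= -CE Cayley_Hamilton mulr0.
rewrite rmorphB rmorphXn /= horner_mx_X horner_mx_C => /eqP.
rewrite subr_eq0 => /eqP CX; exists (\det C).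
by rewrite -det_exp CX det_scalar.
Qed.

Lemma mup_map (k E : fieldType) (phi : {rmorphism k -> E}) (p : {poly k}) a :
  p != 0 -> mup (phi a) (map_poly phi p) = mup a p.
Proof.
move=> p0; have := mup_geq a (mup a p) p0; rewrite leqnn => /esym/dvdpP[r Er].
have ra : ~~ root r a.
  have := mup_geq a (mup a p).+1 p0; rewrite ltnn => /esym/negbT.
  apply: contra => /factor_theorem[s Es]; apply/dvdpP; exists s.
  by rewrite {1}Er Es -mulrA -exprS.
rewrite {1}Er rmorphM rmorphXn /= rmorphB /= map_polyX map_polyC /= mupMr.
  by rewrite mup_XsubCX eqxx.
by rewrite fmorph_root.
Qed.

Lemma mup_exp (E : fieldType) (p : {poly E}) a n :
  p != 0 -> mup a (p ^+ n) = (n * mup a p)%N.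
Proof.
move=> p0; elim: n => [|n IH]; first by rewrite expr0 mupNroot // root1.
by rewrite exprS mupM ?expf_neq0 // IH mulSn.
Qed.

Lemma fraction_num_den (A : idomainType) (z : {fraction A}) :
  exists a b : A, b != 0 /\ z * tofrac b = tofrac a.
Proof.
pose x := generic_quotient.repr z; exists \n_x, \d_x; split; first exact: denom_ratioP.
rewrite -[z]generic_quotient.reprK -/x; unlock tofrac; rewrite -[LHS]FracField.pi_mul.
apply/eqP; rewrite FracField.equivf_def; apply/eqP. rewrite /FracField.mulf.
by rewrite !numden_Ratio ?(oner_neq0, mulr1, mulf_neq0, denom_ratioP) // mulrC.
Qed.

Lemma root_of_ratio (E : fieldType) (u v a b z : E) d e :
    (0 < d)%N -> u != 0 -> v != 0 -> b != 0 -> z * b = a ->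
    z ^+ d = (u / v) ^+ e ->
  a != 0 /\ a ^+ d * v ^+ e = b ^+ d * u ^+ e.
Proof.
move=> d0 u0 v0 b0 <- Ez.
have z0 : z != 0.
  have : z ^+ d != 0 by rewrite Ez expf_neq0 // mulf_neq0 ?invr_eq0.
  by rewrite expf_eq0 d0.
split; first by rewrite mulf_neq0.
rewrite exprMn Ez exprMn exprVn; have : v ^+ e != 0 by rewrite expf_neq0.
by move=> ve; field.
Qed.

Lemma fraction_root (A : idomainType) (u v : A) d e (z : {fraction A}) :
    (0 < d)%N -> u != 0 -> v != 0 -> z ^+ d = (tofrac u / tofrac v) ^+ e ->
  exists a b : A, [/\ a != 0, b != 0 & a ^+ d * v ^+ e = b ^+ d * u ^+ e].
Proof.
move=> d0 u0 v0 Ez; have [a [b [b0 Eab]]] := fraction_num_den z.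
have nz (x : A) : x != 0 -> tofrac x != 0 by rewrite tofrac_eq0.
have [a0 E] := root_of_ratio d0 (nz _ u0) (nz _ v0) (nz _ b0) Eab Ez.
exists a, b; split=> //; first by rewrite -tofrac_eq0.
apply/eqP.
by rewrite -tofrac_eq !tofracM !tofracXn E.
Qed.

Section Independence.
Variables (k : fieldType) (g : {poly k}) (Q d c kappa G : nat).
Hypotheses (g0 : g != 0) (gQ : g \Po 'X^Q = g ^+ Q) (dcQ : (d * c).+1 = Q).
Hypothesis sg : (size g <= G.+1)%N.
Hypothesis kappaQ : (d * kappa + d.-1 * G < Q)%N.
Hypothesis gmult :
  forall e, (0 < e < d)%N -> exists a, ~~ (d %| e * mup a g)%N.

Let A := {poly {poly k}}.
Let gX : A := g%:P.
Let gY : A := map_poly polyC g.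

Let gX0 : gX != 0. Proof. by rewrite polyC_eq0. Qed.

Let gY0 : gY != 0.
Proof. by rewrite map_poly_eq0_id0 ?polyC_eq0 ?lead_coef_eq0. Qed.

Let E := {fraction {poly k}}.
Let toE : {poly k} -> E := @tofrac {poly k}.

(** Over [k(X)] the factor [gX] is a non-zero constant, whereas [gY] vanishes at the constant [x]
    exactly as [g] does. Comparing multiplicities at [x] modulo [d] leaves [e * mup x g]. *)
Lemma power_relation_dvd (a b : A) e :
    a != 0 -> b != 0 -> (0 < d)%N ->
    a ^+ d * gX ^+ e = b ^+ d * gY ^+ e ->
  forall x, (d %| e * mup x g)%N.
Proof.
move=> a0 b0 d0 eqab x.
have inj : injective (map_poly toE).
  apply: map_inj_poly; last exact: tofrac0.
  by move=> u v /eqP; rewrite tofrac_eq => /eqP.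
have nz (p : A) : p != 0 -> map_poly toE p != 0.
  by move=> p0; rewrite -(rmorph0 (map_poly toE)) (inj_eq inj).
pose y : E := toE x%:P.
have mX : mup y (map_poly toE gX) = 0%N.
  rewrite map_polyC mupNroot // /root hornerC tofrac_eq0 //.
have mY : mup y (map_poly toE gY) = mup x g.
  pose phi : {rmorphism k -> E} := toE \o polyC.
  by rewrite /gY -map_poly_comp /= (mup_map phi).
have := congr1 (mup y \o map_poly toE) eqab.
rewrite /= !rmorphM !rmorphXn /= !mupM ?expf_neq0 ?nz // !mup_exp ?nz // mX mY.
rewrite muln0 addn0 => Em; rewrite -(dvdn_addr _ (dvdn_mulr (mup y (map_poly toE b)) (dvdnn d))).
by rewrite -Em dvdn_mulr.
Qed.

(** Let [H(T)] be the sum of the [h j * T^j] and [q(T) = g(X) T^d - g(Y)]. Both vanish at [Y = X^Q],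
    [T = g^c], because [g(X^Q) = g^Q = g * g^(c d)]. Their resultant then vanishes at [Y = X^Q] and
    has degree below [Q] in [X], so it is zero. A common factor of degree [e], [0 < e < d], makes
    [(g(Y)/g(X))^e] a [d]-th power. *)
Lemma stepanov_independent (h : nat -> A) :
    (forall j, (j < d)%N -> inner_deg_le 0 kappa (h j)) ->
    \sum_(j < d) (h j).['X^Q] * g ^+ (c * j) = 0 ->
  forall j, (j < d)%N -> h j = 0.
Proof.
case: (posnP d) => [-> //|d0] hdeg hsum.
have k_lt_Q : (kappa < Q)%N by rewrite (leq_ltn_trans _ kappaQ) // -(prednK d0); lia.
pose H : {poly A} := \poly_(j < d) h j.
pose q : {poly A} := gX *: 'X^d - gY%:P.
suff H0 : H = 0.
  by move=> j jd; have := congr1 (fun p : {poly A} => p`_j) H0; rewrite coef_poly jd coef0.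
apply/eqP; case: eqP => // /eqP H0.
have sH : (size H <= d)%N by apply: size_poly.
have sq : size q = d.+1.
  rewrite size_polyDl size_scale ?size_polyXn //.
  by rewrite size_polyN ltnS (leq_trans (size_polyC_leq1 _)).
pose ev : {rmorphism A -> {poly k}} := horner_eval 'X^Q.
pose full (p : {poly A}) : {poly k} := (map_poly ev p).[g ^+ c].
have fullD p1 p2 : full (p1 + p2) = full p1 + full p2.
  by rewrite /full rmorphD hornerD.
have fullM p1 p2 : full (p1 * p2) = full p1 * full p2.
  by rewrite /full rmorphM hornerM.
have fullH : full H = 0.
  rewrite -[RHS]hsum /full (@horner_coef_wide _ d); last first.
    by rewrite (leq_trans (size_poly _ _)) // (leq_trans sH).
  by apply: eq_bigr => j _; rewrite coef_map coef_poly ltn_ord -exprM.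
have fullq : full q = 0.
  rewrite /full rmorphB /= map_polyC /= map_polyZ /= map_polyXn.
  rewrite hornerD hornerN hornerZ hornerXn hornerC /= /horner_eval hornerC.
  by rewrite -/(g \Po 'X^Q) gQ -exprM mulnC -exprS dcQ subrr.
have resdeg : inner_deg_le 0 (d * kappa + d.-1 * G) (resultant H q).
  (* The [d] rows holding the coefficients of [H] have degree at most [kappa] in [X]; the at most
     [d - 1] rows holding those of [q] have degree at most [G]. *)
  pose b (i : 'I_((size q).-1 + (size H).-1)) :=
    match split i with inl _ => kappa | inr _ => G end.
  have : inner_deg_le 0 (\sum_i b i) (resultant H q).
    apply: inner_deg_le_det => i j; rewrite Sylvester_mxE /b.
    have mulb (p : A) B (t : bool) : inner_deg_le 0 B p -> inner_deg_le 0 B (p *+ t).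
      by case: t => //; rewrite mulr0n => _; apply: inner_deg_le0.
    case: (split i) => m; apply: mulb.
      by rewrite coef_poly; case: ifP => [/hdeg //|_]; apply: inner_deg_le0.
    rewrite coefB coefZ coefXn coefC; apply: inner_deg_leD.
      case: eqP => _; rewrite ?mulr1 ?mulr0; last exact: inner_deg_le0.
      exact: inner_deg_leC.
    apply: inner_deg_leN; case: ifP => _; last exact: inner_deg_le0.
    move=> l; rewrite coef_map size_polyC mul0n addn0.
    by case: eqP.
  apply: inner_deg_leW; rewrite big_split_ord /=.
  under eq_bigr do rewrite /b (unsplitK (inl _)).
  under [X in (_ + X)%N]eq_bigr do rewrite /b (unsplitK (inr _)).
  rewrite !sum_nat_const !card_ord sq /= leq_add2l leq_mul2r; apply/orP; right.
  by rewrite -!subn1 leq_sub2r.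
have res0 : resultant H q = 0.
  case: (ltnP 1 (size H)) => [sH1|sH1].
    have q1 : (1 < size q)%N by rewrite sq.
    have [[u v] _ Eres] := resultant_in_ideal sH1 q1.
    apply: horner_Xn_eq0 resdeg kappaQ _.
    have := congr1 full Eres; rewrite fullD !fullM fullH fullq !mulr0 addr0 => <-.
    by rewrite /full map_polyC hornerC.
  (* When [H] has degree 0 in [T], the base-[Q] expansion applies to [h 0] itself. *)
  have [h0 Eh] : exists h0, H = h0%:P by exists H`_0; apply: size1_polyC.
  case/negP: H0; rewrite Eh polyC_eq0; apply/eqP.
  apply: (@horner_Xn_eq0 _ _ Q kappa) => //.
    by have := hdeg 0%N d0; have := congr1 (fun p : {poly A} => p`_0) Eh;
       rewrite coef_poly d0 coefC eqxx => ->.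
  by have := fullH; rewrite Eh /full map_polyC hornerC.
have := resultant_eq0 H q; rewrite res0 eqxx => /esym sgcd.
set D := gcdp H q in sgcd.
have DH : (size D <= size H)%N by apply: dvdp_leq (dvdp_gcdl H q).
pose toF := @tofrac A.
have toF0 (a : A) : a != 0 -> toF a != 0 by rewrite tofrac_eq0.
have := dvdp_gcdr H q; rewrite -/D => /Pdiv.Idomain.dvdpP[[l r] /= l0 Er].
pose w := toF gY / toF gX.
have sD : size (map_poly toF D) = size D.
  by rewrite size_map_poly_id0 // toF0 // lead_coef_eq0 -size_poly_gt0 ltnW.
have Dw : map_poly toF D %| 'X^d - w%:P.
  have := congr1 (map_poly toF) Er; rewrite map_polyZ rmorphM rmorphB /= map_polyZ.
  rewrite /= map_polyXn map_polyC => Em.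
  apply/dvdpP; exists ((toF l * toF gX)^-1 *: map_poly toF r).
  rewrite -scalerAl -Em scalerA invfM mulrAC mulVf ?mul1r ?toF0 //.
  rewrite scalerBr scalerA mulVf ?toF0 // scale1r; congr (_ - _).
  by rewrite -mul_polyC -polyCM mulrC.
have [|z Ez] := dvdp_XnsubC_pow _ Dw; first by rewrite sD.
set e := (size (map_poly toF D)).-1 in Ez.
have e_lt : (0 < e < d)%N.
  rewrite /e sD; move: sgcd DH sH; case: (size D) => [|[|m]] //= _.
  by move=> h1 h2; apply: leq_trans h1 h2.
have [a [b [a0 b0 Eab]]] := fraction_root d0 gY0 gX0 Ez.
have [x] := gmult e_lt.
by case/negP; apply: (power_relation_dvd a0 b0 d0).
Qed.

End Independence.

(** * The auxiliary polynomial *)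

Lemma pigeonhole (V W : finType) (phi : V -> W) :
  (#|W| < #|V|)%N -> exists v1 v2, v1 != v2 /\ phi v1 = phi v2.
Proof.
move=> lt; have /injectivePn[x [y ne E]] : ~~ injectiveb phi.
  by apply: contraL lt => /injectiveP/leq_card; rewrite -leqNgt.
by exists x, y.
Qed.

(** * Frobenius powers of polynomials *)

Section FrobeniusPoly.
Variables (K : finFieldType) (k : nat).
Local Notation Q := (#|K| ^ k)%N.

Lemma card_pow_pnat : exists2 p, p \in [pchar K] & p.-nat Q.
Proof.
have [p pr_p pK] := finPcharP K; exists p => //.
have En : #|K| = (p ^ logn p #|K|)%N := card_pprimeChar pK.
by rewrite En -expnM pnatX pnat_id.
Qed.

Lemma exprD_card (R : comNzRingType) (f : {rmorphism K -> R}) (x y : R) :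
  (x + y) ^+ Q = x ^+ Q + y ^+ Q.
Proof.
have [p pK pQ] := card_pow_pnat.
apply: exprDn_pchar; apply: sub_in_pnat pQ => r _ /eqP->.
exact: rmorph_pchar f _ pK.
Qed.

Lemma expf_card_pow (x : K) : x ^+ Q = x.
Proof. by elim: k => [|m IH]; rewrite ?expr1 // expnS exprM expf_card IH. Qed.

Lemma poly_exp_card (p : {poly K}) : p ^+ Q = p \Po 'X^Q.
Proof.
elim/poly_ind: p => [|p c IH]; first by rewrite comp_poly0 expr0n expn_eq0 (cardD1 0) inE.
rewrite (exprD_card (@polyC K)) exprMn IH comp_polyD comp_polyM comp_polyX comp_polyC.
by rewrite -polyC_exp expf_card_pow.
Qed.

End FrobeniusPoly.

Section Expansion.
Variables (K : finFieldType) (g : {poly K}) (G : nat).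
Hypothesis sg : (size g <= G.+1)%N.

(** The Taylor expansion of [p(X + U g)], with [U] the outer variable. The increment is proportional
    to [g] so that [g] divides [expand g]. *)
Definition expand : {rmorphism {poly K} -> {poly {poly K}}} :=
  horner_eval ('X%:P + 'X * g%:P) \o map_poly (polyC \o polyC).

Lemma coef_expand (p : {poly K}) i : (expand p)`_i = p^`N(i) * g ^+ i.
Proof.
rewrite /= /horner_eval nderiv_taylor; last exact: mulrC.
set n := size _.
have En : n = size p by rewrite /n size_map_inj_poly // => x y /polyC_inj/polyC_inj.
rewrite coef_sum.
have E (j : nat) : ((map_poly (polyC \o polyC) p)^`N(j).['X%:P] * ('X * g%:P) ^+ j)`_i
   = (p^`N(j) * g ^+ j) *+ (i == j).
  have -> : (map_poly (polyC \o polyC) p)^`N(j).['X%:P] = (p^`N(j))%:P.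
    rewrite nderivn_map map_poly_comp /= horner_map /=.
    by rewrite -/(_ \Po 'X) comp_polyXr.
  rewrite exprMn mulrCA mulrC -polyC_exp -polyCM coefMXn coefC.
  case: ltngtP => [ij|ji|->]; rewrite ?subnn //=.
  by rewrite subn_eq0 leqNgt ji.
under eq_bigr do rewrite E.
rewrite En; case: (ltnP i (size p)) => ip.
  rewrite (bigD1 (Ordinal ip)) //= eqxx big1 ?addr0 // => j.
  by rewrite -val_eqE /= eq_sym => /negbTE->.
rewrite nderivn_poly0 // mul0r big1 // => j _.
by rewrite gtn_eqF // (leq_trans (ltn_ord j)).
Qed.

Lemma size_coef_expand (p : {poly K}) i : (size ((expand p)`_i)%R <= size p + G * i)%N.
Proof.
rewrite coef_expand (leq_trans (size_polyMleq _ _)) //.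
have : (size (p^`N(i))%R <= size p)%N.
  by rewrite (leq_trans (size_poly _ _)) // leq_subr.
have := size_poly_exp_leq g i.
move: (size (g ^+ i)) (size p^`N(i)) => a b ha hb.
have : ((size g).-1 * i <= G * i)%N by rewrite leq_mul2r; lia.
lia.
Qed.

Lemma inner_deg_expand b (p : {poly K}) : (size p <= b.+1)%N -> inner_deg_le G b (expand p).
Proof.
by move=> sp i; rewrite (leq_trans (size_coef_expand _ _)) // -addSn leq_add2r.
Qed.

(** Every Taylor coefficient of [g] at [X + U g] carries a factor [g]. The cofactor [B] has degree
    offset [0], so its powers [B ^+ (c * j)] do not worsen the degree bounds, however large [c]
    is. *)
Lemma expand_g : exists2 B, expand g = g%:P * B & inner_deg_le G 0 B.
Proof.
pose B := \poly_(i < (size g).+1) (if i == 0%N then 1 else g^`N(i) * g ^+ i.-1).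
exists B.
  apply/polyP => i; rewrite coef_expand coefCM coef_poly; case: i => [|i] /=.
    by rewrite nderivn0 expr0 mulrC.
  rewrite ltnS; case: (ltnP i (size g)) => ig; first by rewrite exprS mulrCA.
  by rewrite nderivn_poly0 ?mul0r ?mulr0 // leqW.
move=> i; rewrite coef_poly; case: ifP => _; last by rewrite size_poly0.
case: i => [|i] /=; first by rewrite size_poly1.
rewrite (leq_trans (size_polyMleq _ _)) //.
have : (size (g^`N(i.+1))%R <= size g)%N.
  by rewrite (leq_trans (size_poly _ _)) // leq_subr.
have := size_poly_exp_leq g i.
move: (size (g ^+ i)) (size g^`N(i.+1)) => a b ha hb.
have : ((size g).-1 * i <= G * i)%N by rewrite leq_mul2r; lia.
rewrite mulnS; lia.
Qed.

(* Substituting [X + U g] for [X]: the order of vanishing of [r] along [P] is the order in [U] of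
   the expansion modulo [P], because [expand P = P + U (P' g + ...)]. *)
Lemma dvdp_exp_of_expand (P r : {poly K}) M :
    coprimep P P^`() -> coprimep P g ->
    (forall l, (l < M)%N -> P %| (expand r)`_l) ->
  P ^+ M %| r.
Proof.
move=> cP' cPg; elim: M => [|M IH] H; first by rewrite expr0 dvd1p.
have /dvdpP[s Er] := IH (fun l lM => H l (ltnW lM)).
pose V := drop_poly 1 (expand P).
have EP : expand P = P%:P + 'X * V.
  rewrite -[LHS](poly_take_drop 1) expr1 [_ * 'X]mulrC; congr (_ + _).
  apply/polyP=> i; rewrite coef_take_poly coefC; case: i => [|i] //.
  by rewrite coef_expand nderivn0 expr0 mulr1.
have V0 : V`_0 = P^`() * g.
  by rewrite coef_drop_poly add0n coef_expand nderivn1 expr1.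
have [Z EZ] : exists Z, expand P ^+ M = ('X * V) ^+ M + P%:P * Z.
  exists (\sum_(i < M) expand P ^+ (M.-1 - i) * ('X * V) ^+ i).
  apply/eqP; rewrite addrC -subr_eq; apply/eqP.
  by rewrite subrXX EP addrK.
(* This is the coefficient of [U^M] in [expand r], reduced modulo [P]. *)
have : P %| s * (P^`() * g) ^+ M.
  have := H M (leqnn _); rewrite Er rmorphM rmorphXn EZ mulrDr coefD mulrCA coefCM.
  rewrite (dvdp_addl _ (dvdp_mulr _ (dvdpp P))) exprMn mulrCA coefXnM ltnn subnn.
  by rewrite -!horner_coef0 hornerM horner_exp !horner_coef0 V0 coef_expand nderivn0 expr0 mulr1.
rewrite Gauss_dvdpl; last by rewrite coprimep_expr // coprimepMr cP'.
by rewrite Er exprS => Ps; rewrite dvdp_mul.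
Qed.

End Expansion.

Lemma size_sum_leq (R : nzSemiRingType) (I : finType) (F : I -> {poly R}) n :
  (forall i, (size (F i) <= n)%N) -> (size (\sum_i F i)%R <= n)%N.
Proof.
by move=> H; apply: leq_trans (size_sum _ _ _) _; apply/bigmax_leqP => i _; apply: H.
Qed.

Section Stepanov.
Variables (K : finFieldType) (g : {poly K}) (G d' J' c kappa M k : nat).
Local Notation Q := (#|K| ^ k)%N.
Local Notation d := d'.+1.
Local Notation J := J'.+1.
Hypotheses (sg : (size g <= G.+1)%N) (MQ : (M <= Q)%N) (kappa0 : (0 < kappa)%N).
Hypothesis kappaQ : (d * kappa.-1 + d' * G < Q)%N.
Hypothesis independent : forall h : nat -> {poly {poly K}},
  (forall j, (j < d)%N -> inner_deg_le 0 kappa.-1 (h j)) ->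
  \sum_(j < d) (h j).['X^Q] * g ^+ (c * j) = 0 -> forall j, (j < d)%N -> h j = 0.
Hypothesis count : (M * (kappa + J + M * G) < d * J * kappa)%N.

Let V := {ffun 'I_d * 'I_J -> 'rV[K]_kappa}.
Let kp (v : V) (j i : nat) : {poly K} := rVpoly (v (inord j, inord i)).

Let kpB v w j i : kp (v - w) j i = kp v j i - kp w j i.
Proof. by rewrite /kp !ffunE linearB. Qed.

Let size_kp v j i : (size (kp v j i) <= kappa)%N.
Proof. exact: size_poly. Qed.

(** The coefficient of [U^l] in the expansion of the auxiliary polynomial, once [X^Q] is replaced by
    [X] and the expansion of [g^c] by [z * B^c]. As [P] does not occur in it, one linear system
    handles all the [P] at once. *)
Let cond (z : K) (B : {poly {poly K}}) (v : V) (l : nat) : {poly K} :=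
  \sum_(j < d) \sum_(i < J) z ^+ j *: ('X^i * (expand g (kp v j i) * B ^+ (c * j))`_l).

Let auxpoly (v : V) : {poly K} :=
  \sum_(j < d) (\poly_(i < J) kp v j i).['X^Q] * g ^+ (c * j).

(** There are [d J kappa] unknowns in [K], and [M] conditions with at most [kappa + J + M G]
    coefficients each. Since [K] is finite, the pigeonhole principle replaces linear algebra: the
    difference of two families with equal values of the conditions is a solution. *)
Lemma stepanov_solution z B : inner_deg_le G 0 B ->
  exists2 v, v != 0 & forall l, (l < M)%N -> cond z B v l = 0.
Proof.
move=> Bdeg; pose b := (kappa + J + M * G)%N.
pose phi (v : V) := [ffun l : 'I_M => poly_rV (cond z B v l) : 'rV[K]_b].
have condB v w l : cond z B (v - w) l = cond z B v l - cond z B w l.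
  rewrite /cond -sumrB; apply: eq_bigr => j _; rewrite -sumrB; apply: eq_bigr => i _.
  by rewrite kpB rmorphB mulrBl coefB mulrBr scalerBr.
have [|v1 [v2 [ne eq12]]] := @pigeonhole _ _ phi.
  rewrite !card_ffun !card_mx !mul1n card_prod !card_ord -!expnM.
  have q1 : (1 < #|K|)%N by apply: finNzRing_gt1.
  by rewrite ltn_exp2l // mulnC (leq_trans count) // mulnC.
exists (v1 - v2) => [|l lM]; first by rewrite subr_eq0.
have := congr1 (fun f : {ffun 'I_M -> 'rV[K]_b} => f (Ordinal lM)) eq12.
rewrite !ffunE /= => /eqP; rewrite -subr_eq0 -linearB -condB => /eqP E.
rewrite -[LHS](@poly_rV_K _ b) ?E ?linear0 //; move: (v1 - v2) => v {E}.
apply: size_sum_leq => j; apply: size_sum_leq => i.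
rewrite (leq_trans (size_scale_leq _ _)) //.
rewrite (leq_trans (size_polyMleq _ _)) // size_polyXn addSn /=.
have /(_ l) : inner_deg_le G (kappa.-1 + c * j * 0) (expand g (kp v j i) * B ^+ (c * j)).
  apply: inner_deg_leM; last exact: inner_deg_le_exp.
  by apply: inner_deg_expand; rewrite // prednK.
move: (size _) => s; rewrite muln0 addn0 => Hs.
have : (G * l <= M * G)%N by rewrite mulnC leq_mul2r ltnW ?orbT.
have := ltn_ord i; rewrite /b; lia.
Qed.

Let horner_kp v j : (\poly_(i < J) kp v j i).['X^Q] = \sum_(i < J) kp v j i * 'X^Q ^+ i.
Proof. exact: horner_poly. Qed.

Lemma auxpoly_neq0 v : v != 0 -> auxpoly v != 0.
Proof.
apply: contraNneq => aux0; apply/eqP/ffunP => -[j i]; rewrite ffunE.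
have := independent (h := fun j => \poly_(i < J) kp v j i) _ aux0 (ltn_ord j).
move=> /(_ _)/(congr1 (fun p : {poly {poly K}} => p`_i)).
rewrite coef_poly ltn_ord coef0 /kp !inord_val => E.
apply: (can_inj rVpolyK); rewrite linear0 E // => j0 _ l.
rewrite mul0n addn0 prednK // coef_poly; case: ifP => _; first exact: size_kp.
by rewrite size_poly0.
Qed.

Lemma size_auxpoly v : (d * c <= Q)%N -> (size (auxpoly v) <= Q * (J + G))%N.
Proof.
move=> dcQ; apply: size_sum_leq => j.
rewrite horner_kp mulr_suml; apply: size_sum_leq => i.
rewrite -exprM (leq_trans (size_polyMleq _ _)) //.
have := size_poly_exp_leq g (c * j).
have : (size (kp v j i * 'X^(Q * i)%N)%R <= kappa + Q * i)%N.
  by rewrite (leq_trans (size_polyMleq _ _)) // size_polyXn addnS /= leq_add2r.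
move: (size _) (size _) => s1 s2 h1 h2.
have h3 : ((size g).-1 * (c * j) <= Q * G)%N.
  rewrite mulnC leq_mul //; last by move: sg; lia.
  rewrite (leq_trans _ dcQ) // mulnC leq_mul2r; apply/orP; right.
  by rewrite ltnW.
have h4 : (Q * i <= Q * J')%N by rewrite leq_mul2l -ltnS ltn_ord orbT.
have h5 : (kappa <= Q)%N.
  by move: kappaQ; rewrite mulSn; move: (_ * _.-1)%N (_ * G)%N => x y; lia.
rewrite mulnDr mulnS; lia.
Qed.

Lemma dvdp_auxpoly (z : K) (v : V) B (P : {poly K}) :
    expand g g = g%:P * B -> (forall l, (l < M)%N -> cond z B v l = 0) ->
    coprimep P P^`() -> coprimep P g -> P %| 'X^Q - 'X -> P %| g ^+ c - z%:P ->
  P ^+ M %| auxpoly v.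
Proof.
move=> EB Hv cP' cPg PX Pg; apply: (dvdp_exp_of_expand cP' cPg).
(* [I] is the ideal generated by [P] and [U^M]; the next facts are the usual rules for congruences
   modulo it. *)
pose I (p : {poly {poly K}}) := forall l, (l < M)%N -> P %| p`_l.
have I_add p1 p2 : I p1 -> I p2 -> I (p1 + p2).
  by move=> H1 H2 l lM; rewrite coefD dvdp_add ?H1 ?H2.
have I_mul p1 p2 : I p1 -> I (p1 * p2).
  move=> H1 l lM; rewrite coefM; apply: (big_ind (fun r => P %| r)) => [|? ?|i _]; [exact: dvdp0|exact: dvdp_add|].
  by rewrite dvdp_mulr // H1 // (leq_ltn_trans _ lM) // -ltnS ltn_ord.
have I_C p : P %| p -> I p%:P.
  by move=> Pp l _; rewrite coefC; case: ifP => // _; exact: dvdp0.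
have I_exp p1 p2 n : I (p1 - p2) -> I (p1 ^+ n - p2 ^+ n).
  by move=> H; rewrite subrXX; apply: (I_mul).
have I_M p1 p2 r1 r2 : I (p1 - p2) -> I (r1 - r2) -> I (p1 * r1 - p2 * r2).
  move=> H1 H2; have -> : p1 * r1 - p2 * r2 = (p1 - p2) * r1 + (r1 - r2) * p2 by ring.
  by apply: (I_add); apply: (I_mul).
have I_sum (T : finType) (F1 F2 : T -> {poly {poly K}}) :
    (forall i, I (F1 i - F2 i)) -> I (\sum_i F1 i - \sum_i F2 i).
  move=> H; rewrite -sumrB; apply: (big_ind I) => [l _||i _]; [by rewrite coef0 dvdp0 | exact: I_add | exact: H].
(* Here [(X + U g)^Q = X^Q + U^Q g^Q], where [U^Q] lies in [I] because [M <= Q], and [P] divides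
   [X^Q - X]. *)
have IXQ : I (expand g 'X^Q - 'X%:P).
  have -> : expand g 'X^Q - 'X%:P = ('X^Q - 'X)%:P + 'X^Q * (g ^+ Q)%:P.
    rewrite rmorphXn /= /horner_eval map_polyX hornerX.
    rewrite (exprD_card _ (@polyC _ \o @polyC K)) exprMn !polyC_exp /= polyCB polyC_exp.
    by ring.
  apply: (I_add); first exact: I_C.
  move=> l lM; rewrite coefXnM (leq_trans lM MQ); exact: dvdp0.
have Igc : I ((g ^+ c)%:P - (z%:P)%:P) by rewrite -polyCB; apply: (I_C).
pose target := \sum_(j < d) (\sum_(i < J) expand g (kp v j i) * 'X%:P ^+ i)
                 * ((z%:P)%:P * B ^+ c) ^+ j.
have : I (expand g (auxpoly v) - target).
  rewrite rmorph_sum; apply: (I_sum) => j; rewrite rmorphM; apply: (I_M).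
    rewrite horner_kp rmorph_sum; apply: (I_sum) => i; rewrite rmorphM rmorphXn.
    apply: (I_M); first by rewrite subrr => l _; rewrite coef0 dvdp0.
    exact: I_exp.
  rewrite rmorphXn exprM; apply: (I_exp); rewrite EB exprMn -polyC_exp.
  by apply: (I_M) => //; rewrite subrr => l _; rewrite coef0 dvdp0.
move=> H l lM; have := H l lM; rewrite coefB.
suff -> : target`_l = 0 by rewrite subr0.
rewrite -[RHS](Hv l lM) /target /cond coef_sum; apply: eq_bigr => j _.
rewrite mulr_suml coef_sum; apply: eq_bigr => i _.
have -> : expand g (kp v j i) * 'X%:P ^+ i * ((z%:P)%:P * B ^+ c) ^+ j
    = (z ^+ j *: 'X^i)%:P * (expand g (kp v j i) * B ^+ (c * j)).
  by rewrite exprMn -exprM -!polyC_exp -mul_polyC polyCM; ring.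
by rewrite coefCM -scalerAl.
Qed.

Lemma stepanov_auxiliary (z : K) : (d * c <= Q)%N ->
  exists R : {poly K}, [/\ R != 0, (size R <= Q * (J + G))%N &
    forall P, coprimep P P^`() -> coprimep P g -> P %| 'X^Q - 'X ->
      P %| g ^+ c - z%:P -> P ^+ M %| R].
Proof.
move=> dcQ; have [B EB Bdeg] := expand_g sg.
have [v v0 Hv] := stepanov_solution z Bdeg.
exists (auxpoly v); split; [exact: auxpoly_neq0 | exact: size_auxpoly |].
by move=> P; apply: dvdp_auxpoly Hv.
Qed.

End Stepanov.

(** * Irreducible polynomials over a finite field *)

(** The quotient by [P] is presented as an abstract finite field with a generator [x], so that
    divisibility by [P] becomes vanishing at [x]. *)
Lemma residue_field (K : finFieldType) (P : {poly K}) :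
    irreducible_poly P -> P \is monic ->
  exists (F : finFieldType) (iota : {rmorphism K -> F}) (x : F),
    (forall p, (P %| p) = ((map_poly iota p).[x] == 0)) /\
    (forall y, exists p, y = (map_poly iota p).[x]) /\
    #|F| = (#|K| ^ (size P).-1)%N.
Proof.
move=> Pirr Pmon; pose MI : monic_irreducible_poly P := (Pirr, Pmon).
pose F : finFieldType := {poly %/ P with MI}.
pose red : {rmorphism {poly K} -> F} := in_qpoly P.
have redE p : (map_poly (red \o polyC) p).[red 'X] = red p.
  by rewrite map_poly_comp horner_map /= -/(_ \Po 'X) comp_polyXr.
exists F, (red \o polyC), (red 'X); split; last split; last exact: card_qfpoly.
  by move=> p; rewrite redE /red -val_eqE /= mk_monicE //= -Pdiv.IdomainMonic.modpE.
by move=> y; exists (val y); rewrite redE /red; apply: val_inj; rewrite [RHS]in_qpoly_small ?size_mk_monic.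
Qed.

Lemma card_pow_natr0 (K : finFieldType) k : (0 < k)%N -> (#|K| ^ k)%:R = 0 :> K.
Proof.
move=> k0; have [p pr_p pK] := finPcharP K.
have En : #|K| = (p ^ logn p #|K|)%N := card_pprimeChar pK.
have : (1 < #|K|)%N by apply: finNzRing_gt1.
rewrite En; case: (logn _ _) => // n _.
by rewrite -expnM -[k]prednK // natrX (pcharf0 pK) mulSn addSn exprS mul0r.
Qed.

Lemma horner_map_pow_card (K : finFieldType) (F : comNzRingType) (iota : {rmorphism K -> F})
    (p : {poly K}) (x : F) i :
  (map_poly iota p).[x ^+ (#|K| ^ i)] = (map_poly iota p).[x] ^+ (#|K| ^ i).
Proof.
have := congr1 (fun r => (map_poly iota r).[x]) (poly_exp_card i p).
rewrite rmorphXn horner_exp => ->.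
by rewrite map_comp_poly map_polyXn horner_comp hornerXn.
Qed.

Lemma det_horner_XsubC (R : comNzRingType) n (C : 'M[R]_n.+1) a :
  \det (horner_mx C ('X - a%:P)) = (-1) ^+ n.+1 * (char_poly C).[a].
Proof.
rewrite -/(horner_eval a _) -det_map_mx -detZ scaleN1r; congr (\det _).
rewrite rmorphB /= horner_mx_X horner_mx_C; apply/matrixP => i j.
by rewrite !mxE /= /horner_eval hornerD hornerN hornerC hornerMn hornerX opprB.
Qed.

Section Irreducible.
Variables (K : finFieldType) (P : {poly K}).
Hypotheses (Pirr : irreducible_poly P) (Pmon : P \is monic).
Local Notation q := #|K|.
Local Notation e := (size P).-1.

Lemma irreducible_dvdp_XnsubX k : (e %| k)%N -> P %| 'X^(q ^ k) - 'X.
Proof.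
move=> /dvdnP[m ->]; have [F [iota [x [xP [_ cF]]]]] := residue_field Pirr Pmon.
rewrite xP rmorphB /= map_polyXn map_polyX hornerD hornerN hornerXn hornerX.
by rewrite mulnC expnM -cF expf_card_pow subrr.
Qed.

Lemma irreducible_deg_gt0 : (0 < e)%N.
Proof. by case: Pirr; case: (size P) => [|[]]. Qed.

(** If [P] divided its derivative, it would divide the derivative of [X^(q^e) - X], which is
    [-1]. *)
Lemma irreducible_coprime_deriv : coprimep P P^`().
Proof.
rewrite irreducible_poly_coprime //; apply/negP => PP'.
have /dvdpP[r /(congr1 (@deriv K))] := irreducible_dvdp_XnsubX (dvdnn e).
rewrite derivB derivXn derivX derivM -mulr_natl -polyC_natr.
rewrite card_pow_natr0 ?irreducible_deg_gt0 // mul0r sub0r => E.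
have : P %| 1 by rewrite -dvdpNr E dvdp_add // dvdp_mull.
by rewrite dvdp1; case: Pirr => + _; case: (size P) => [|[]].
Qed.

(** Frobenius fixes the coefficients of [P], so the [x ^+ (q ^ i)] are roots. They are distinct: if
    [x ^+ (q ^ t) = x] with [0 < t < e], all of [F], made of polynomials in [x], would consist of
    roots of [X^(q^t) - X], which are too few. *)
Lemma irreducible_conjugates (F : finFieldType) (iota : {rmorphism K -> F}) (x : F) :
    (forall p, (P %| p) = ((map_poly iota p).[x] == 0)) ->
    (forall y, exists p, y = (map_poly iota p).[x]) ->
    #|F| = (q ^ e)%N ->
  map_poly iota P = \prod_(i < e) ('X - (x ^+ (q ^ i))%:P).
Proof.
move=> xP xsurj cF; have q1 : (1 < q)%N by apply: finNzRing_gt1.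
pose rs := [seq x ^+ (q ^ i) | i <- seq.iota 0 e].
have xqe : x ^+ (q ^ e) = x by rewrite -cF expf_card.
have hornerq := horner_map_pow_card iota _ x.
have x_ne t : (0 < t < e)%N -> x ^+ (q ^ t) != x.
  move=> /andP[t0 te]; apply/eqP => xqt.
  have /(max_poly_roots _) := enum_uniq F.
  move=> /(_ ('X^(q ^ t) - 'X)) H.
  have qt1 : (q ^ 0 < q ^ t)%N by rewrite ltn_exp2l.
  have sX : size ('X^(q ^ t) - 'X : {poly F}) = (q ^ t).+1.
    by rewrite size_polyDl size_polyXn // size_polyN size_polyX ltnS -[1%N](expn0 q).
  have : (#|F| < (q ^ t).+1)%N.
    rewrite cardE -sX; apply: H; first by rewrite -size_poly_gt0 sX.
    apply/allP => y _; have [p ->] := xsurj y.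
    by rewrite rootE !hornerE -hornerq xqt subrr.
  by rewrite ltnS cF leq_exp2l // leqNgt te.
have rs_uniq : uniq rs.
  rewrite map_inj_in_uniq ?iota_uniq // => i j; rewrite !mem_iota !add0n /=.
  wlog ij : i j / (i <= j)%N.
    by move=> W ie je E; case: (leqP i j) => [|/ltnW] h; [|apply/esym]; apply: W.
  move=> _ je E; apply/eqP; rewrite eqn_leq ij leqNgt; apply/negP => lt_ij.
  have t0 : (0 < e - j + i < e)%N by move: je lt_ij; move: e => m; lia.
  have := x_ne _ t0; rewrite expnD mulnC exprM E -exprM -expnD subnKC; last exact: ltnW.
  by rewrite xqe eqxx.
have := @all_roots_prod_XsubC _ (map_poly iota P) rs _ _ _.
rewrite size_map_poly size_map size_iota uniq_rootsE lead_coef_map (monicP Pmon).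
rewrite rmorph1 scale1r big_map -[X in seq.iota 0 X]subn0 -/(index_iota 0 e) big_mkord; apply => //.
  by rewrite prednK // ltnW //; case: Pirr.
apply/allP => _ /mapP[i _ ->].
by rewrite rootE hornerq expf_eq0 -xP dvdpp andbT expn_gt0 ltnW.
Qed.

(* The reciprocity [Res(P, f) = +- Norm f(x)], with [x] the class of [X] modulo [P]. *)
Lemma det_horner_mod n (C : 'M[K]_n.+1) :
  P %| char_poly C ^+ (\sum_(i < e) q ^ i) -
       ((-1) ^+ (e * n.+1) * \det (horner_mx C P))%:P.
Proof.
have [F [iota [x [xP [xsurj cF]]]]] := residue_field Pirr Pmon.
rewrite xP rmorphB /= map_polyC hornerD hornerN hornerC subr_eq0; apply/eqP.
rewrite rmorphXn horner_exp. rewrite /= rmorphM rmorphXn rmorphN1.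
rewrite -[iota (\det _)]det_map_mx (map_horner_mx iota) (irreducible_conjugates xP xsurj cF) rmorph_prod /=.
have -> : \det (\prod_(i < e) horner_mx (map_mx iota C) ('X - (x ^+ (q ^ i))%:P))
    = \prod_(i < e) \det (horner_mx (map_mx iota C) ('X - (x ^+ (q ^ i))%:P)).
  by apply: (big_morph (fun A : 'M_n.+1 => \det A)) => [A B|]; rewrite ?det1 // det_mulmx.
have -> : (-1) ^+ (e * n.+1) = \prod_(i < e) (-1) ^+ n.+1 :> F.
  by rewrite prodr_const card_ord mulnC exprM.
rewrite -big_split /=.
rewrite expr_sum; apply: eq_bigr => i _.
rewrite det_horner_XsubC mulrA -expr2 -exprM muln2 -signr_odd odd_double mul1r.
by rewrite -map_char_poly horner_map_pow_card.
Qed.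

End Irreducible.

(** * The L-function of a multiplicative function on monic polynomials *)

Section MonicPoly.
Variable K : finFieldType.

(** Monic polynomials of degree [m] are indexed by their lower coefficients, a finite type over
    which one can sum. *)
Definition mpol m (v : 'rV[K]_m) : {poly K} := 'X^m + rVpoly v.

Lemma size_mpol m (v : 'rV[K]_m) : size (mpol v) = m.+1.
Proof. by rewrite size_polyDl size_polyXn // ltnS size_poly. Qed.

Lemma mpol_monic m (v : 'rV[K]_m) : mpol v \is monic.
Proof.
by rewrite monicE lead_coefDl ?size_polyXn ?ltnS ?size_poly // lead_coefXn.
Qed.

Lemma mpol_neq0 m (v : 'rV[K]_m) : mpol v != 0.
Proof. exact: monic_neq0 (mpol_monic v). Qed.

Lemma mpolK m (v : 'rV[K]_m) : poly_rV (mpol v) = v.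
Proof.
apply/rowP => i; rewrite mxE coefD coefXn coef_rVpoly_ord ltn_eqF ?add0r //.
Qed.

Lemma mpol_inj m : injective (@mpol m).
Proof. exact: can_inj (@mpolK m). Qed.

Lemma poly_rVK_monic m (p : {poly K}) : p \is monic -> size p = m.+1 ->
  mpol (poly_rV p : 'rV_m) = p.
Proof.
move=> pm sp; apply/polyP => i; rewrite coefD coefXn coef_rVpoly.
case: insubP => [j ij jE|]; first by rewrite mxE -jE ltn_eqF ?add0r ?ltn_ord.
rewrite addr0 -leqNgt leq_eqVlt => /orP[/eqP <-|mi].
  by rewrite eqxx; move/monicP: pm; rewrite lead_coefE sp /= => ->.
by rewrite gtn_eqF // nth_default // sp.
Qed.

Definition irr m (v : 'rV[K]_m) := irreducibleb (mpol v).

Lemma irrP m (v : 'rV[K]_m) : reflect (irreducible_poly (mpol v)) (irr v).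
Proof. exact: irreducibleP. Qed.

Lemma irr_deg_gt0 m (v : 'rV[K]_m) : irr v -> (0 < m)%N.
Proof. by move/irrP => /irreducible_deg_gt0; rewrite size_mpol. Qed.

Lemma irreducible_factor m (h : {poly K}) : size h = m.+2 ->
  exists e (v : 'rV[K]_e), irr v /\ mpol v %| h.
Proof.
move=> sh; have h0 : h != 0 by rewrite -size_poly_gt0 sh.
pose good e := (0 < e)%N && [exists v : 'rV[K]_e, mpol v %| h].
have exg : exists e, good e.
  exists m.+1; apply/andP; split=> //; apply/existsP.
  exists (poly_rV ((lead_coef h)^-1 *: h)); rewrite poly_rVK_monic.
  - by rewrite dvdpZl ?dvdpp // invr_eq0 lead_coef_eq0.
  - by rewrite monicE lead_coefZ mulVf ?lead_coef_eq0.
  - by rewrite size_scale // invr_eq0 lead_coef_eq0.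
case: (ex_minnP exg) => e /andP[e0 /existsP[v vh]] emin.
exists e, v; split=> //; apply/irrP; split; first by rewrite size_mpol ltnS.
move=> r sr rv; have r0 : r != 0 by apply: contraTneq rv => ->; rewrite dvd0p mpol_neq0.
rewrite -dvdp_size_eqp // eqn_leq dvdp_leq ?mpol_neq0 //= size_mpol.
have sr2 : (1 < size r)%N by rewrite ltn_neqAle eq_sym sr size_poly_gt0.
rewrite -(prednK (ltnW sr2)) ltnS; apply: emin; apply/andP; split.
  by rewrite -ltnS prednK // ltnW.
apply/existsP; exists (poly_rV ((lead_coef r)^-1 *: r)); rewrite poly_rVK_monic.
- by rewrite dvdpZl ?invr_eq0 ?lead_coef_eq0 // (dvdp_trans rv).
- by rewrite monicE lead_coefZ mulVf ?lead_coef_eq0.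
- by rewrite size_scale ?invr_eq0 ?lead_coef_eq0 // prednK // ltnW.
Qed.

Lemma irr_dvdp_irr e1 e2 (v1 : 'rV[K]_e1) (v2 : 'rV[K]_e2) :
  irr v1 -> irr v2 -> mpol v1 %| mpol v2 -> mpol v1 = mpol v2.
Proof.
move=> i1 /irrP[_ H] dv; apply/eqP; rewrite -eqp_monic ?mpol_monic //.
apply: H => //; rewrite size_mpol eqSS -lt0n; exact: irr_deg_gt0 i1.
Qed.

Lemma size_mpol_exp m (v : 'rV[K]_m) a : size (mpol v ^+ a) = (m * a).+1.
Proof.
have := size_exp (mpol v) a; rewrite size_mpol /= => <-.
by rewrite prednK // size_poly_gt0 expf_neq0 // mpol_neq0.
Qed.

Lemma dvdp_mpol_exp_bound m (v : 'rV[K]_m) a (h : {poly K}) :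
  h != 0 -> mpol v ^+ a %| h -> (m * a < size h)%N.
Proof. by move=> h0 /(dvdp_leq h0); rewrite size_mpol_exp. Qed.

(** The degree identity behind the logarithmic derivative: [P] contributes its degree once for each
    power of it dividing [h]. The free bound [n] keeps the ranges fixed during the induction, which
    strips one irreducible factor from [h]. *)
Lemma deg_sum_prime_powers n m (h : {poly K}) :
    h \is monic -> size h = m.+1 -> (m <= n)%N ->
  m = (\sum_(1 <= e < n.+1) \sum_(v : 'rV[K]_e | irr v) \sum_(1 <= a < n.+1)
         e * (mpol v ^+ a %| h)%R)%N.
Proof.
elim/ltn_ind: m h => -[|m] IH h hm sh mn.
  rewrite big1_seq // => e /andP[_]; rewrite mem_index_iota => /andP[e0 _].
  rewrite big1 // => v vi; rewrite big1_seq // => a /andP[_].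
  rewrite mem_index_iota => /andP[a0 _].
  case: (boolP (_ %| _)) => [/(dvdp_mpol_exp_bound (monic_neq0 hm))|_]; last by rewrite muln0.
  by rewrite sh ltnS leqNgt muln_gt0 e0 a0.
have [e0 [v0 [i0 d0]]] := irreducible_factor sh.
have e00 := irr_deg_gt0 i0.
have /dvdpP[h1 Eh] := d0.
have h1m : h1 \is monic by move: hm; rewrite Eh monicMr ?mpol_monic.
have h10 := monic_neq0 h1m.
have Es : m.+1 = ((size h1).-1 + e0)%N.
  have := congr1 (fun p : {poly K} => size p) Eh.
  have : (0 < size h1)%N by rewrite size_poly_gt0.
  rewrite sh size_monicM ?mpol_neq0 // size_mpol; move: (size h1) => s; lia.
have sh1 : size h1 = (size h1).-1.+1 by rewrite prednK // size_poly_gt0.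
have lt1 : ((size h1).-1 < m.+1)%N by rewrite Es -[X in (X < _)%N]addn0 ltn_add2l.
have IH1 := IH _ lt1 h1 h1m sh1 (ltnW (leq_trans lt1 mn)).
rewrite {1}Es {1}IH1.
have -> : e0 = (\sum_(1 <= e < n.+1) \sum_(v : 'rV[K]_e | irr v)
                 e * (mpol v == mpol v0))%N.
  have e0n : (e0 < n.+1)%N by rewrite ltnS (leq_trans _ mn) // Es leq_addl.
  rewrite (bigD1_seq e0) /= ?iota_uniq //; last by rewrite mem_index_iota e00 e0n.
  rewrite (bigD1 v0) //= eqxx muln1 big1 ?addn0 => [|v /andP[_ ne]]; last first.
    by rewrite (inj_eq (@mpol_inj _)) (negbTE ne) muln0.
  rewrite big1 ?addn0 // => e ne; rewrite big1 // => v _.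
  case: eqP => [/(congr1 (fun p : {poly K} => size p))|_]; last by rewrite muln0.
  by rewrite !size_mpol => -[E]; rewrite E eqxx in ne.
rewrite -big_split; apply: eq_bigr => e _ /=; rewrite -big_split; apply: eq_bigr => v vi /=.
case: eqP => [E|/eqP ne]; last first.
  rewrite muln0 addn0; apply: eq_bigr => a _; congr (_ * nat_of_bool _)%N.
  rewrite Eh Gauss_dvdpl // coprimep_expl // irreducible_poly_coprime; last exact/irrP.
  by apply: contra ne => dv; apply/eqP; apply: irr_dvdp_irr dv.
rewrite muln1 big_add1 /=.
have n0 : (0 < n)%N by apply: leq_trans mn.
(* [P^a] divides [h1 * P] exactly when [P^(a-1)] divides [h1]. The shift adds the term of exponent
   [0] and drops that of exponent [n], which is zero for degree reasons. *)
rewrite [RHS](eq_big_nat _ _ (F2 := fun a => e * (mpol v ^+ a.-1 %| h1)%R)%N); last first.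
  move=> a /andP[a0 _]; rewrite Eh -E -[in LHS](prednK a0) exprSr.
  by rewrite dvdp_mul2r ?mpol_neq0.
rewrite big_add1 /= -{1}(prednK n0) big_nat_recr //= -[X in _ = \sum_(0 <= _ < X) _](prednK n0).
rewrite [RHS]big_nat_recl //= expr0 dvd1p muln1 addnC; congr addn.
rewrite (prednK n0); case: (boolP (_ %| h1)); rewrite ?muln0 ?addn0 //.
move=> /(dvdp_mpol_exp_bound h10); rewrite sh1 ltnS => le.
have : (n <= (size h1).-1)%N by rewrite (leq_trans _ le) // leq_pmull // (irr_deg_gt0 vi).
by rewrite leqNgt (leq_trans lt1 mn).
Qed.

End MonicPoly.

(** * Newton's identities for the coefficients of the L-function *)

Section NewtonIdentity.
Variables (K : finFieldType) (R : comNzRingType) (psi : {poly K} -> R).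
Hypotheses (psi1 : psi 1 = 1) (psiM : {morph psi : p1 p2 / p1 * p2}).

Definition Lcoef m : R := \sum_(v : 'rV[K]_m) psi (mpol v).

Definition prime_power_sum e a : R :=
  \sum_(v : 'rV[K]_e | irr v) e%:R * psi (mpol v) ^+ a.

(** By the Euler product, this is the coefficient of [T^k] in [T L'(T) / L(T)]. *)
Definition Lpsum k : R :=
  \sum_(1 <= e < k.+1 | (e %| k)%N) prime_power_sum e (k %/ e).

Lemma Lcoef0 : Lcoef 0 = 1.
Proof.
rewrite /Lcoef (big_pred1 0) => [|v]; last by rewrite /= (thinmx0 v) eqxx.
by rewrite /mpol linear0 addr0.
Qed.

Lemma psi_exp p n : psi (p ^+ n) = psi p ^+ n.
Proof. by elim: n => [|n IH]; rewrite ?psi1 // !exprS psiM IH. Qed.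

Lemma sum_multiples m t (p : {poly K}) : p \is monic -> size p = t.+1 ->
  \sum_(v : 'rV[K]_m | p %| mpol v) psi (mpol v) =
  if (t <= m)%N then psi p * Lcoef (m - t) else 0.
Proof.
move=> pm sp; have p0 := monic_neq0 pm.
case: leqP => [tm|mt]; last first.
  rewrite big_pred0 // => v; apply/negbTE/negP => /(dvdp_leq (mpol_neq0 v)).
  by rewrite sp size_mpol ltnS leqNgt mt.
have mulE (w : 'rV[K]_(m - t)) : mpol (poly_rV (p * mpol w) : 'rV_m) = p * mpol w.
  rewrite poly_rVK_monic //; first by rewrite monicMl // mpol_monic.
  by rewrite size_monicM ?mpol_neq0 // sp size_mpol addSn /= addnS subnKC.
have divE (v : 'rV[K]_m) : p %| mpol v ->
    mpol (poly_rV (mpol v %/ p) : 'rV_(m - t)) = mpol v %/ p.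
  move=> pv; rewrite poly_rVK_monic //.
    have := mpol_monic v; rewrite -{1}(divpK pv) monicMr //.
  by rewrite size_divp // sp size_mpol /= subSn.
rewrite (reindex_onto (fun w : 'rV[K]_(m - t) => poly_rV (p * mpol w))
   (fun v => poly_rV (mpol v %/ p))) /=; last first.
  by move=> v pv; apply: mpol_inj; rewrite mulE divE // mulrC divpK.
rewrite /Lcoef mulr_sumr; apply: eq_big => [w|w _]; last by rewrite mulE psiM.
by rewrite mulE dvdp_mulr // mulKp // mpolK eqxx.
Qed.

(** Both sides compute the sum of [deg h * psi h] over the monic [h] of degree [m]: on the right,
    [deg h] is written as a sum over the prime powers dividing [h], and the multiples of each prime
    power are collected. *)
Lemma Lcoef_newton m : m%:R * Lcoef m = \sum_(1 <= k < m.+1) Lpsum k * Lcoef (m - k).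
Proof.
pose X e a := if (e * a <= m)%N then prime_power_sum e a * Lcoef (m - e * a) else 0.
transitivity (\sum_(1 <= e < m.+1) \sum_(1 <= a < m.+1) X e a).
  rewrite mulr_sumr.
  transitivity (\sum_(v : 'rV[K]_m) \sum_(1 <= e < m.+1) \sum_(w : 'rV[K]_e | irr w)
     \sum_(1 <= a < m.+1) (if mpol w ^+ a %| mpol v then e%:R * psi (mpol v) else 0)).
    apply: eq_bigr => v _.
    rewrite {1}(deg_sum_prime_powers (mpol_monic v) (size_mpol v) (leqnn m)).
    rewrite natr_sum mulr_suml; apply: eq_bigr => e _.
    rewrite natr_sum mulr_suml; apply: eq_bigr => w _.
    rewrite natr_sum mulr_suml; apply: eq_bigr => a _.
    by rewrite natrM; case: ifP; rewrite ?mulr1 // mulr0 mul0r.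
  rewrite exchange_big /=; apply: eq_bigr => e _.
  rewrite exchange_big /=.
  transitivity (\sum_(w : 'rV[K]_e | irr w) \sum_(1 <= a < m.+1)
     if (e * a <= m)%N then e%:R * psi (mpol w) ^+ a * Lcoef (m - e * a) else 0).
    apply: eq_bigr => w _; rewrite exchange_big /=; apply: eq_bigr => a _.
    rewrite -big_mkcond /= -mulr_sumr (@sum_multiples m (e * a)).
    - by case: ifP; rewrite ?mulr0 // psi_exp mulrA.
    - by rewrite monic_exp // mpol_monic.
    - by rewrite size_mpol_exp.
  rewrite exchange_big /=; apply: eq_bigr => a _; rewrite /X.
  by case: ifP => _; [rewrite -mulr_suml | rewrite big1].
transitivity (\sum_(1 <= k < m.+1) \sum_(1 <= e < m.+1) \sum_(1 <= a < m.+1)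
   if k == (e * a)%N then prime_power_sum e a * Lcoef (m - k) else 0).
  symmetry; rewrite exchange_big /=; apply: eq_big_nat => e /andP[e0 _].
  rewrite exchange_big /=; apply: eq_big_nat => a /andP[a0 _].
  by rewrite -big_mkcond /= big_nat1_eq muln_gt0 e0 a0 /X.
apply: eq_big_nat => k /andP[k0 km]; rewrite /Lpsum mulr_suml.
rewrite [RHS]big_mkcond (@big_cat_nat _ _ _ k.+1 1 m.+1) //=.
rewrite [X in _ + X]big_nat_cond.
rewrite [X in _ + X]big1 ?addr0 => [|e /andP[/andP[ke _] _]]; last first.
  rewrite big_nat big1 // => a /andP[a0 _].
  by rewrite ltn_eqF // (leq_trans ke) // leq_pmulr.
apply: eq_big_nat => e /andP[e0 ek].
rewrite -big_mkcond /=; case: ifP => [/dvdnP[a Ek]|ndv].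
  rewrite (eq_bigl (fun i => i == a)).
    rewrite big_nat1_eq Ek mulnK // mulnC ifT //.
    have a0 : (0 < a)%N by move: k0; rewrite Ek muln_gt0 => /andP[].
    by rewrite a0 (leq_trans _ km) // ltnS Ek leq_pmulr.
  by move=> i /=; rewrite Ek mulnC eqn_pmul2l // eq_sym.
rewrite big1 // => a /eqP Ek.
by rewrite Ek dvdn_mulr in ndv.
Qed.
End NewtonIdentity.

Section TrivialCharacter.
Variables (K : finFieldType) (R : comNzRingType).

Lemma Lcoef_trivial m : Lcoef (fun _ : {poly K} => 1 : R) m = (#|K| ^ m)%:R.
Proof. by rewrite /Lcoef sumr_const card_mx mul1n. Qed.

(** With [A_m = q^m] the recurrence forces [S_k = q^k]. This counts the elements of the field with
    [q^k] elements by their minimal polynomials. *)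
Lemma Lpsum_trivial k : (0 < k)%N -> Lpsum (fun _ : {poly K} => 1 : R) k = (#|K| ^ k)%:R.
Proof.
elim/ltn_ind: k => -[|k] // IH _.
have := @Lcoef_newton K R (fun=> 1) erefl (fun _ _ => esym (mulr1 1)) k.+1.
rewrite big_nat_recr //= subnn !Lcoef_trivial expn0 mulr1.
rewrite (eq_big_nat _ _ (F2 := fun=> (#|K| ^ k.+1)%:R)); last first.
  move=> i /andP[i0 ik]; rewrite IH // Lcoef_trivial -natrM -expnD subnKC //.
  exact: ltnW.
rewrite sumr_const_nat subSS subn0 -natr1 mulrDl mul1r mulr_natl => /addrI <-.
by [].
Qed.

End TrivialCharacter.

(** * Power sums of inverse roots and their growth *)

Section PowerSums.
Variable R : comNzRingType.

Definition rev_prod (ws : seq R) : {poly R} := \prod_(w <- ws) (1 - w *: 'X).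

(** By induction on [ws]: a new factor [1 - w T] adds the powers [w ^+ k] to the power sums, and
    their contribution telescopes. *)
Lemma rev_prod_newton (ws : seq R) m :
  m%:R * (rev_prod ws)`_m =
  - \sum_(1 <= k < m.+1) (\sum_(w <- ws) w ^+ k) * (rev_prod ws)`_(m - k).
Proof.
elim: ws m => [|w ws IH] m.
  rewrite /rev_prod big_nil coefC big1_seq => [|k _]; last by rewrite big_nil mul0r.
  by case: m => [|m]; rewrite ?mul0r ?mulr0 oppr0.
case: m => [|m]; first by rewrite big_geq // mul0r oppr0.
have E i : (rev_prod (w :: ws))`_i.+1 = (rev_prod ws)`_i.+1 - w * (rev_prod ws)`_i.
  by rewrite /rev_prod big_cons mulrBl mul1r -scalerAl coefB coefZ coefXM.
have E0 : (rev_prod (w :: ws))`_0 = (rev_prod ws)`_0.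
  by rewrite /rev_prod big_cons mulrBl mul1r -scalerAl coefB coefZ coefXM /= mulr0 subr0.
have IH1 := IH m.+1; have IH0 := IH m.
set a := rev_prod ws in E E0 IH1 IH0 *; set b := rev_prod (w :: ws) in E E0 *.
rewrite E mulrBr IH1 mulrCA -natr1 mulrDl mul1r IH0.
have -> : \sum_(1 <= k < m.+2) (\sum_(w0 <- w :: ws) w0 ^+ k) * b`_(m.+1 - k) =
  \sum_(1 <= k < m.+2) (\sum_(w0 <- ws) w0 ^+ k) * a`_(m.+1 - k)
  - w * (\sum_(1 <= k < m.+1) (\sum_(w0 <- ws) w0 ^+ k) * a`_(m - k)) + w * a`_m.
  have Eb k : (0 < k)%N -> (k < m.+1)%N -> b`_(m.+1 - k) = a`_(m.+1 - k) - w * a`_(m - k).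
    by move=> k0 km; rewrite subSn // E.
  have tele : \sum_(1 <= k < m.+2) w ^+ k * b`_(m.+1 - k) = w * a`_m.
    rewrite big_nat_recr //= subnn E0.
    pose u k := - (w ^+ k * a`_(m.+1 - k)).
    rewrite (eq_big_nat _ _ (F2 := fun k => u k.+1 - u k)); last first.
      by move=> k /andP[k0 km]; rewrite Eb // /u mulrBr mulrA -exprSr subSS opprK addrC.
    by rewrite telescope_sumr // /u subnn expr1 subSS subn0; ring.
  rewrite (eq_big_nat _ _ (F2 := fun k => (\sum_(w0 <- ws) w0 ^+ k) * b`_(m.+1 - k)
     + w ^+ k * b`_(m.+1 - k))); last first.
    by move=> k _; rewrite big_cons mulrDl addrC.
  rewrite big_split /= tele; congr (_ + _).
  have recr (F : nat -> R) : \sum_(1 <= k < m.+2) F k = \sum_(1 <= k < m.+1) F k + F m.+1.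
    by rewrite big_nat_recr.
  rewrite !recr subnn E0 addrAC; congr (_ + _).
  rewrite mulr_sumr -sumrB; apply: eq_big_nat => k /andP[k0 km].
  by rewrite Eb // mulrBr mulrCA.
by ring.
Qed.

End PowerSums.

(** [L] is a polynomial with constant term [1], hence a product of factors [1 - w T]. Its
    coefficients satisfy the same triangular recurrence with [Lpsum psi k] and with minus the power
    sums of the [w], so these agree. *)
Lemma Lpsum_roots (K : finFieldType) (C : closedFieldType) (psi : {poly K} -> C) D :
    psi 1 = 1 -> {morph psi : p1 p2 / p1 * p2} ->
    (forall m, (D < m)%N -> Lcoef psi m = 0) ->
  exists2 ws : seq C, (size ws <= D)%N &
    forall k, (0 < k)%N -> Lpsum psi k = - \sum_(w <- ws) w ^+ k.
Proof.
move=> psi1 psiM A0; pose p : {poly C} := \poly_(i < D.+1) Lcoef psi i.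
have pE i : p`_i = Lcoef psi i.
  by rewrite coef_poly; case: ltnP => // /A0 ->.
have p0 : p`_0 = 1 by rewrite pE Lcoef0.
have pn0 : p != 0 by apply: contra_eq_neq p0 => ->; rewrite coef0 eq_sym oner_eq0.
have [zs Ep] := closed_field_poly_normal p.
have lc0 : lead_coef p != 0 by rewrite lead_coef_eq0.
have zs0 z : z \in zs -> z != 0.
  move=> zzs; apply: contraTneq zzs => ->; apply/negP => z0.
  have : root p 0 by rewrite Ep rootZ // root_prod_XsubC.
  by rewrite rootE horner_coef0 p0 oner_eq0.
pose ws := [seq z^-1 | z <- zs].
have Ew : p = rev_prod ws.
  have E : p = (lead_coef p * \prod_(z <- zs) (- z)) *: rev_prod ws.
    rewrite {1}Ep -scalerA; congr (_ *: _).
    rewrite /rev_prod big_map; elim: (zs) zs0 => [|z s IH] zs0; first by rewrite !big_nil scale1r.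
    have z0 : z != 0 by rewrite zs0 ?mem_head.
    rewrite !big_cons IH => [|y ys]; last by rewrite zs0 // in_cons ys orbT.
    rewrite -scalerAr [- z * _]mulrC -scalerA; congr (_ *: _).
    by rewrite scalerAl scalerBr scalerA mulNr mulfV // scaleN1r opprK -mul_polyC mulr1 polyCN addrC.
  have : (rev_prod ws)`_0 = 1.
    rewrite -horner_coef0 horner_prod big1 // => w _.
    by rewrite hornerD hornerN hornerZ hornerX mulr0 subr0 hornerC.
  have := congr1 (fun r : {poly C} => r`_0) E; rewrite /= coefZ p0 => + E1.
  by rewrite E1 mulr1 => Ec; rewrite E -Ec scale1r.
exists ws.
  rewrite size_map -ltnS; have := congr1 (fun r : {poly C} => size r) Ep.
  rewrite size_scale // size_prod_XsubC => <-; exact: size_poly.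
elim/ltn_ind => -[|k] // IH _.
have := Lcoef_newton psi1 psiM k.+1; rewrite -pE {1}Ew rev_prod_newton -Ew.
rewrite -sumrN big_nat_recr //= [in RHS]big_nat_recr //= subnn p0 (Lcoef0 psi1) !mulr1 => E.
apply/esym; move: E.
rewrite (eq_big_nat _ _ (F2 := fun i => Lpsum psi i * Lcoef psi (k.+1 - i))); last first.
  by move=> i /andP[i0 ik]; rewrite IH // pE mulNr.
by move/addrI.
Qed.

Lemma bernoulli (R : numDomainType) (y : R) m : 0 <= y -> 1 + y *+ m <= (1 + y) ^+ m.
Proof.
move=> y0; elim: m => [|m IH]; first by rewrite mulr0n addr0.
rewrite exprS; apply: le_trans (ler_wpM2l _ IH); last by rewrite addr_ge0.
rewrite mulrDl mul1r mulrDr mulr1 -addrA lerD2l mulrS addrC lerD2l.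
by rewrite lerDl mulr_ge0 // mulrn_wge0.
Qed.

Lemma exp_unbounded (R : archiNumFieldType) (x B : R) m0 : 1 < x -> 0 <= B ->
  exists2 m, (m0 <= m)%N & B < x ^+ m.
Proof.
move=> x1 B0; have y0 : 0 < x - 1 by rewrite subr_gt0.
have BB : 0 <= B / (x - 1) by rewrite divr_ge0 // ltW.
have := archi_boundP BB; set n := Num.bound _ => Bn.
exists (m0 + n)%N; first exact: leq_addr.
have -> : x = 1 + (x - 1) by rewrite addrC subrK.
apply: lt_le_trans (bernoulli _ (ltW y0)).
rewrite ltr_pdivrMr // in Bn; apply: lt_le_trans Bn _.
rewrite mulr_natl mulrnDr addrA -[X in X <= _]add0r lerD2r.
by rewrite addr_ge0 ?mulrn_wge0 // ltW.
Qed.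

(* A polynomial vanishing at all [u <> w] among the [ws] turns the bound on the power sums into
   a bound on the powers of [w] alone. *)
Lemma power_sums_bound (R : archiNumFieldType) (ws : seq R) (r B : R) m0 :
    0 < r -> (forall m, (m0 <= m)%N -> `|\sum_(w <- ws) w ^+ m| <= B * r ^+ m) ->
  forall w, w \in ws -> `|w| <= r.
Proof.
move=> r0 H w wws; rewrite real_leNgt ?normr_real ?gtr0_real //; apply/negP => rw.
pose P := \prod_(u <- rem w (undup ws)) ('X - u%:P).
have Pw : P.[w] != 0.
  rewrite -rootE root_prod_XsubC; have := undup_uniq ws => uu.
  by rewrite (mem_rem_uniq _ uu) !inE eqxx.
have Pu u : u \in ws -> u != w -> P.[u] = 0.
  move=> uws uw; apply/rootP; rewrite root_prod_XsubC.
  by rewrite (mem_rem_uniq _ (undup_uniq ws)) !inE uw mem_undup.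
have key m : \sum_(j < size P) P`_j * (\sum_(u <- ws) u ^+ (m + j)) =
    (w ^+ m * P.[w]) *+ count_mem w ws.
  under eq_bigr do rewrite mulr_sumr.
  rewrite exchange_big /=.
  transitivity (\sum_(u <- ws) if u == w then w ^+ m * P.[w] else 0).
    apply: eq_big_seq => u uws.
    have -> : \sum_(j < size P) P`_j * u ^+ (m + j) = u ^+ m * P.[u].
      by rewrite horner_coef mulr_sumr; apply: eq_bigr => j _; rewrite exprD mulrCA.
    by case: eqP => [->//|/eqP uw]; rewrite Pu // mulr0.
  by rewrite -big_mkcond /= big_const_seq iter_addr_0.
pose B1 := \sum_(j < size P) `|P`_j| * (B * r ^+ j).
have bnd m : (m0 <= m)%N -> `|w| ^+ m * `|P.[w]| <= B1 * r ^+ m.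
  move=> mm; have : `|(w ^+ m * P.[w]) *+ count_mem w ws| <= B1 * r ^+ m.
    rewrite -key mulr_suml; apply: le_trans (ler_norm_sum _ _ _) _.
    apply: ler_sum => j _; rewrite normrM -mulrA ler_wpM2l // -mulrA -exprD addnC.
    by apply: H; rewrite (leq_trans mm) // leq_addl.
  apply: le_trans; rewrite normrMn normrM normrX.
  have cnt : (0 < count_mem w ws)%N by rewrite -has_count has_pred1.
  by rewrite -(prednK cnt) mulrS lerDl mulrn_wge0 // mulr_ge0 // exprn_ge0.
have x1 : 1 < `|w| / r by rewrite ltr_pdivlMr // mul1r.
pose B2 := B1 / `|P.[w]|.
have bnd2 m : (m0 <= m)%N -> (`|w| / r) ^+ m <= B2.
  move=> /bnd h; rewrite exprMn exprVn ler_pdivrMr ?exprn_gt0 // /B2 mulrAC.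
  by rewrite ler_pdivlMr // normr_gt0.
have B20 : 0 <= B2.
  by apply: le_trans (bnd2 _ (leqnn _)); rewrite exprn_ge0 // divr_ge0 // ltW.
have [m /bnd2 le lt] := exp_unbounded m0 x1 B20.
by have := le_lt_trans le lt; rewrite ltxx.
Qed.

(** * Multiplicative characters *)

(** A faithful character of [K^*], extended by [0]: every multiplicative character is one of its
    powers. *)
Record faithful_character (K : finFieldType) := FaithfulCharacter {
  char_fun :> K -> algC;
  char0 : char_fun 0 = 0;
  char1 : char_fun 1 = 1;
  charM : {morph char_fun : x y / x * y};
  char_inj : forall x, char_fun x = 1 -> x = 1
}.

Lemma finField_prim_root (K : finFieldType) : exists x : K, (#|K|.-1).-primitive_root x.
Proof.
have q1 : (1 < #|K|)%N by apply: finNzRing_gt1.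
have n0 : (0 < #|K|.-1)%N by case: #|K| q1 => [|[]].
pose rs := [seq x <- enum K | x != 0].
have : has (#|K|.-1).-primitive_root rs.
  apply: has_prim_root => //.
  - apply/allP => x; rewrite mem_filter => /andP[x0 _].
    apply/unity_rootP; apply: (mulfI x0).
    by rewrite -exprS prednK ?expf_card ?mulr1 // ltnW.
  - by rewrite filter_uniq // enum_uniq.
  - have : (size rs + 1 = #|K|)%N.
      rewrite size_filter cardE -(count_predC (fun x : K => x != 0) (enum K)); congr addn.
      rewrite (eq_count (a2 := pred1 0)); last by move=> x; rewrite /= negbK.
      by rewrite count_uniq_mem ?enum_uniq // mem_enum.
    by move=> <-; rewrite addn1.
by case/hasP => x _ xp; exists x.
Qed.

Lemma finField_expf_card1 (K : finFieldType) (x : K) : x != 0 -> x ^+ #|K|.-1 = 1.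
Proof.
move=> x0; apply: (mulfI x0).
by rewrite -exprS prednK ?expf_card ?mulr1 // ltnW // finNzRing_gt1.
Qed.

Lemma faithful_character_exists (K : finFieldType) : faithful_character K.
Proof.
have [g gp] := sigW (finField_prim_root K).
have n0 := prim_order_gt0 gp.
have [z zp] := C_prim_root_exists n0.
have logP (x : K) : exists i : nat, (x != 0) ==> (x == g ^+ i).
  have [->|x0] := eqVneq x 0; first by exists 0%N.
  by have [i ->] := prim_rootP gp (finField_expf_card1 x0); exists i; rewrite eqxx implybT.
pose lg x := xchoose (logP x).
have lgP x : x != 0 -> x = g ^+ lg x.
  by move=> x0; apply/eqP; apply: (implyP (xchooseP (logP x))).
pose th x := if x == 0 then 0 else z ^+ lg x.
have g0 : g != 0 by rewrite (prim_root_eq0 gp) -lt0n.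
have thE i : th (g ^+ i) = z ^+ i.
  rewrite /th expf_eq0 (negbTE g0) andbF; apply/eqP.
  by rewrite (eq_prim_root_expr zp) -(eq_prim_root_expr gp) -lgP // expf_neq0.
exists th.
- by rewrite /th eqxx.
- by rewrite -(expr0 g) thE expr0.
- move=> x y; have [->|x0] := eqVneq x 0; first by rewrite mul0r /th eqxx mul0r.
  have [->|y0] := eqVneq y 0; first by rewrite mulr0 /th eqxx mulr0.
  by rewrite (lgP _ x0) (lgP _ y0) -exprD !thE exprD.
- move=> x; have [->|x0] := eqVneq x 0; first by rewrite /th eqxx => /esym/eqP; rewrite oner_eq0.
  rewrite (lgP _ x0) thE -(expr0 z) => /eqP.
  by rewrite (eq_prim_root_expr zp) -(eq_prim_root_expr gp) expr0 => /eqP.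
Qed.

Section CharacterTheory.
Variables (K : finFieldType) (theta : faithful_character K).

Lemma charX x n : theta (x ^+ n) = theta x ^+ n.
Proof. by elim: n => [|n IH]; rewrite ?char1 // !exprS charM IH. Qed.

Lemma char_pow_card x : x != 0 -> theta x ^+ #|K|.-1 = 1.
Proof. by move=> x0; rewrite -charX finField_expf_card1 // char1. Qed.

Lemma char_eq0 x : (theta x == 0) = (x == 0).
Proof.
apply/idP/eqP => [th0|->]; last by rewrite char0.
apply/eqP; apply: contraTT th0 => x0; apply/negP => /eqP th0.
have := char_pow_card x0; rewrite th0 expr0n => /eqP.
have : (1 < #|K|)%N by apply: finNzRing_gt1.
by case: #|K| => [|[|n]] //= _; rewrite eq_sym oner_eq0.
Qed.

Lemma norm_char x : x != 0 -> `|theta x| = 1.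
Proof.
move=> x0; have := congr1 Num.norm (char_pow_card x0); rewrite normrX normr1 => /eqP.
rewrite -[X in _ == X -> _](expr1n _ #|K|.-1) eqrXn2 ?ler01 // => [/eqP //|].
by have : (1 < #|K|)%N by [apply: finNzRing_gt1]; case: #|K| => [|[|]].
Qed.

(** Multiplication by a [d]-th root of unity [u <> 1] permutes the index set and multiplies the sum
    by [theta u], which is not [1] by faithfulness. *)
Lemma sum_char_roots_of_unity d : (1 < d)%N -> (d %| #|K|.-1)%N ->
  \sum_(z : K | z ^+ d == 1) theta z = 0.
Proof.
move=> d1 /dvdnP[m Em].
have [g gp] := finField_prim_root K.
have n0 := prim_order_gt0 gp.
pose u := g ^+ m.
have ud : u ^+ d = 1 by rewrite -exprM -Em prim_expr_order.
have u1 : u != 1.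
  have m0 : (0 < m)%N by move: n0; rewrite Em muln_gt0 => /andP[].
  rewrite -(expr0 g) (eq_prim_root_expr gp) mod0n modn_small -?lt0n //.
  by rewrite Em ltn_Pmulr.
have u0 : u != 0 by apply: contra_eq_neq ud => ->; rewrite expr0n gtn_eqF ?(ltnW d1) // eq_sym oner_eq0.
have E : \sum_(z : K | z ^+ d == 1) theta z = theta u * \sum_(z : K | z ^+ d == 1) theta z.
  rewrite mulr_sumr (reindex_inj (mulfI u0)) /=.
  by apply: eq_big => z; rewrite ?charM // exprMn ud mul1r.
have : (1 - theta u) * \sum_(z : K | z ^+ d == 1) theta z = 0.
  by rewrite mulrBl mul1r -E subrr.
move/eqP; rewrite mulf_eq0 subr_eq0 => /orP[/eqP/esym/char_inj/eqP|/eqP//].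
by rewrite (negbTE u1).
Qed.

Lemma card_roots_of_unity d : (0 < d)%N -> (#|[pred z : K | z ^+ d == 1%R]| <= d)%N.
Proof.
move=> d0; rewrite cardE.
have sX : size ('X^d - 1 : {poly K}) = d.+1 by rewrite size_XnsubC.
rewrite -ltnS -sX; apply: max_poly_roots; last exact: enum_uniq.
  by rewrite -size_poly_gt0 sX.
apply/allP => z; rewrite mem_enum inE => /eqP zd.
by rewrite rootE !hornerE zd subrr.
Qed.

End CharacterTheory.

(** * Counting points by the auxiliary polynomial *)

(** Extends the reciprocity from degree [e] to multiples [e * m]: raising to the power
    [#|K| ^ (e * m)] is trivial modulo [P], so each block of [e] exponents contributes the same
    factor. *)
Lemma residue_norm (K : finFieldType) (P : {poly K}) n (C : 'M[K]_n.+1) m :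
    irreducible_poly P -> P \is monic ->
  P %| char_poly C ^+ (\sum_(i < (size P).-1 * m) #|K| ^ i) -
       ((-1) ^+ ((size P).-1 * m * n.+1) * \det (horner_mx C P) ^+ m)%:P.
Proof.
move=> Pirr Pmon; have := det_horner_mod Pirr Pmon C.
have [F [iota [x [xP [_ cF]]]]] := residue_field Pirr Pmon.
set e := (size P).-1 in cF *; rewrite !xP.
rewrite !rmorphB /= !map_polyC !hornerD !hornerN !hornerC !subr_eq0 /= => /eqP E.
apply/eqP; elim: m => [|m IH].
  by rewrite muln0 mul0n big_ord0 !expr0 mulr1 !rmorph1 hornerC.
rewrite mulnS addnC big_split_ord /= exprD rmorphM hornerM IH.
have -> : (\sum_(i < e) #|K| ^ (e * m + i) = #|K| ^ (e * m) * \sum_(i < e) #|K| ^ i)%N.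
  by rewrite big_distrr /=; apply: eq_bigr => i _; rewrite expnD.
have cpow s : (map_poly iota (char_poly C ^+ (#|K| ^ (e * m) * s))).[x] =
    (map_poly iota (char_poly C ^+ s)).[x].
  by rewrite !rmorphXn !horner_exp exprM expnM -cF expf_card_pow.
rewrite cpow E /=.
rewrite -!rmorphM; congr (iota _).
by rewrite mulnDl exprD exprSr; ring.
Qed.

(** In the degree identity for [R], made monic, each such [P] contributes its degree for all
    exponents from [1] to [M]. *)
Lemma sum_deg_le (K : finFieldType) (R : {poly K}) M k (c : {poly K} -> bool) :
    R != 0 ->
    (forall e (v : 'rV[K]_e), (e %| k)%N -> irr v -> c (mpol v) -> mpol v ^+ M %| R) ->
  (M * (\sum_(1 <= e < k.+1 | (e %| k)%N) \sum_(v : 'rV[K]_e | irr v && c (mpol v)) e)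
    < size R)%N.
Proof.
move=> R0 H; pose R1 := (lead_coef R)^-1 *: R.
have lc0 : (lead_coef R)^-1 != 0 by rewrite invr_eq0 lead_coef_eq0.
have R1m : R1 \is monic by rewrite monicE lead_coefZ mulVf // lead_coef_eq0.
have sR1 : size R1 = (size R).-1.+1 by rewrite size_scale // prednK // size_poly_gt0.
pose n := (maxn (size R).-1 (maxn k M)).
have sn : ((size R).-1 <= n)%N by rewrite leq_maxl.
have kn : (k.+1 <= n.+1)%N by rewrite ltnS !leq_max leqnn !orbT.
have Mn : (M.+1 <= n.+1)%N by rewrite ltnS !leq_max leqnn !orbT.
rewrite -[X in (_ < X)%N](prednK (n := size R)) ?size_poly_gt0 // ltnS.
rewrite {1}(deg_sum_prime_powers R1m sR1 sn).
rewrite (@big_cat_nat _ _ _ k.+1 1 n.+1) //= (leq_trans _ (leq_addr _ _)) //.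
rewrite big_distrr /= big_mkcond /=; apply: leq_sum => e _; case: ifP => // ek.
rewrite big_distrr /= big_mkcondr /=; apply: leq_sum => v vi; case: ifP => // cv.
rewrite (@big_cat_nat _ _ _ M.+1 1 n.+1) //= (leq_trans _ (leq_addr _ _)) //.
rewrite (eq_big_nat _ _ (F2 := fun=> e)); last first.
  move=> a /andP[a0 aM]; rewrite dvdpZr // (dvdp_trans _ (H _ _ ek vi cv)) ?muln1 //.
  by rewrite dvdp_exp2l.
by rewrite sum_nat_const_nat subSS subn0.
Qed.

Section StepanovCount.
Variables (K : finFieldType) (L : fieldType) (iota : {rmorphism K -> L}).
Variables (g : {poly K}) (G d : nat).
Hypotheses (g0 : g != 0) (sg : (size g <= G.+1)%N) (d0 : (0 < d)%N).
Hypothesis gmult :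
  forall e, (0 < e < d)%N -> exists x, ~~ (d %| e * mup x (map_poly iota g))%N.

(** The multiplicities are controlled over [L], where [g] may have its roots; the relation is mapped
    there and the conclusion comes back by injectivity. *)
Lemma stepanov_independent_map Q c kappa (h : nat -> {poly {poly K}}) k :
    Q = (#|K| ^ k)%N -> (d * c).+1 = Q -> (d * kappa + d.-1 * G < Q)%N ->
    (forall j, (j < d)%N -> inner_deg_le 0 kappa (h j)) ->
    \sum_(j < d) (h j).['X^Q] * g ^+ (c * j) = 0 ->
  forall j, (j < d)%N -> h j = 0.
Proof.
move=> EQ dcQ kQ hdeg hsum j jd.
pose m : {rmorphism {poly K} -> {poly L}} := map_poly iota.
have := @stepanov_independent L (m g) Q d c kappa G _ _ dcQ _ kQ gmult
  (fun j => map_poly m (h j)).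
rewrite map_poly_eq0 g0 size_map_poly sg => /(_ isT).
have gQ : m g \Po 'X^Q = m g ^+ Q.
  by rewrite -rmorphXn /= EQ poly_exp_card map_comp_poly map_polyXn.
move=> /(_ gQ isT) H.
have {}H : map_poly m (h j) = 0.
  apply: H => //.
    move=> i id l; rewrite coef_map size_map_poly; exact: hdeg.
  rewrite -[RHS](rmorph0 m) -hsum rmorph_sum; apply: eq_bigr => i _.
  by rewrite rmorphM rmorphXn -horner_map /= map_polyXn.
apply: (map_inj_poly (@map_poly_inj _ _ iota) (rmorph0 m)).
by rewrite H; apply/esym/(rmorph0 (map_poly m)).
Qed.

(** The number of [x] in the field with [q^k] elements such that [g(x)^c = z], an irreducible
    polynomial of degree [e] standing for [e] conjugates. *)
Definition point_count k c (z : K) : nat :=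
  (\sum_(1 <= e < k.+1 | (e %| k)%N)
     \sum_(v : 'rV[K]_e | irr v && (mpol v %| g ^+ c - z%:P)%R) e)%N.

(* Stepanov's bound; the parameters are [J = t], [M = d t - A] and [kappa = c - G]. *)
Lemma stepanov_count mu c (z : K) (t := (#|K| ^ mu)%N) :
    (d * c).+1 = (t * t)%N -> (4 * d * (1 + d * G) <= t)%N -> z != 0 ->
  (d * point_count (mu + mu) c z <=
     t * t + 2 * (2 * d * d * (1 + d * G) + G) * t)%N.
Proof.
move=> dcQ tbig z0; set A := (2 * d * d * (1 + d * G))%N.
have EQ : (#|K| ^ (mu + mu) = t * t)%N by rewrite expnD.
have indep0 h kappa :=
  @stepanov_independent_map (t * t) c kappa h (mu + mu) (esym EQ) dcQ.
case: (d) d0 dcQ tbig @A indep0 => // d' _ dcQ tbig A indep0.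
have tt : (t <= t * t)%N by rewrite leq_pmulr // expn_gt0 ltnW // finNzRing_gt1.
have dt : (d'.+1 <= t)%N by rewrite (leq_trans _ tbig) // -mulnA mulnCA leq_pmulr // muln_gt0.
have cG : (G < c)%N.
  rewrite -(ltn_pmul2l (ltn0Sn d')) -ltnS dcQ.
  apply: leq_trans tt; apply: leq_trans tbig; nia.
have At : (2 * A <= d'.+1 * t)%N.
  have -> : (2 * A = d'.+1 * (4 * d'.+1 * (1 + d'.+1 * G)))%N by rewrite /A; ring.
  by rewrite leq_mul2l tbig orbT.
have [t' Et] : exists t', t = t'.+1 by exists t.-1; rewrite prednK // (leq_trans _ dt).
pose M := (d'.+1 * t - A)%N.
have dtt : (d'.+1 * t <= t * t)%N by rewrite leq_mul2r dt orbT.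
have MQ : (M <= #|K| ^ (mu + mu))%N by rewrite EQ (leq_trans (leq_subr _ _)).
have kap0 : (0 < c - G)%N by rewrite subn_gt0.
have kapQ : (d'.+1 * (c - G).-1 + d' * G < #|K| ^ (mu + mu))%N.
  rewrite EQ -dcQ ltnS; nia.
have cnt : (M * ((c - G) + t'.+1 + M * G) < d'.+1 * t'.+1 * (c - G))%N.
  rewrite -Et.
  have MA : (d'.+1 * t = M + A)%N by rewrite subnK // (leq_trans _ At) // leq_pmull.
  rewrite MA mulnDl -addnA mulnDr ltn_add2l.
  have Mdt : (M <= d'.+1 * t)%N by rewrite leq_subr.
  (* The value of [A] comes from here: as [A = 2 d * d (1 + d G)], the requirement becomes
     [t^2 < 2 d (c - G)], and [d c = t^2 - 1] leaves enough room. *)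
  have h1 : (M * (t + M * G) <= (d'.+1 * (1 + d'.+1 * G)) * (t * t))%N.
    have -> : ((d'.+1 * (1 + d'.+1 * G)) * (t * t)
       = (d'.+1 * t) * (t + (d'.+1 * t) * G))%N by ring.
    by rewrite leq_mul // leq_add2l leq_mul2r Mdt orbT.
  apply: leq_ltn_trans h1 _.
  have -> : (A * (c - G) = (d'.+1 * (1 + d'.+1 * G)) * (2 * d'.+1 * (c - G)))%N.
    by rewrite /A; ring.
  rewrite ltn_pmul2l ?muln_gt0 //.
  have : (2 * d'.+1 * (c - G) = 2 * (d'.+1 * c) - 2 * (d'.+1 * G))%N.
    by rewrite -mulnA mulnBr mulnBr.
  have : (4 * (1 + d'.+1 * G) <= t)%N.
    by apply: leq_trans tbig; rewrite -mulnA leq_mul2l /= leq_pmull.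
  move: dcQ tt; move: (d'.+1 * c)%N (d'.+1 * G)%N (t * t)%N => x y w; lia.
have dc : (d'.+1 * c <= #|K| ^ (mu + mu))%N by rewrite EQ -dcQ.
have indep (h : nat -> {poly {poly K}}) :
  (forall j, (j < d'.+1)%N -> inner_deg_le 0 (c - G).-1 (h j)) ->
  \sum_(j < d'.+1) (h j).['X^(#|K| ^ (mu + mu))] * g ^+ (c * j) = 0 ->
  forall j, (j < d'.+1)%N -> h j = 0.
  by rewrite EQ; apply: indep0; rewrite -EQ.
have [R [R0 sR HR]] := stepanov_auxiliary sg MQ kap0 kapQ indep cnt z dc.
have le1 : (M * point_count (mu + mu) c z < size R)%N.
  apply: (sum_deg_le (c := fun p => p %| g ^+ c - z%:P)) => // e v ek vi vz.
  have vP := irrP _ vi; apply: HR => //.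
  - exact: irreducible_coprime_deriv vP (mpol_monic v).
  - rewrite irreducible_poly_coprime //; apply/negP => vg.
    have : mpol v %| z%:P.
      have -> : z%:P = g ^+ c - (g ^+ c - z%:P) by rewrite opprB addrC subrK.
      rewrite dvdp_sub // dvdp_exp // (leq_ltn_trans _ cG) //.
    by move/dvdp_leq; rewrite polyC_eq0 z0 size_mpol size_polyC z0 ltnS leqNgt (irr_deg_gt0 vi) => /(_ isT).
  - by apply: (irreducible_dvdp_XnsubX vP (mpol_monic v)); rewrite size_mpol.
have le2 : (M * point_count (mu + mu) c z <= t * t * (t + G))%N.
  by rewrite (leq_trans (ltnW le1)) // (leq_trans sR) // EQ -Et.
move: le2; move: (point_count _ _ _) => N le2.
have A0 : (0 < A)%N by rewrite /A !muln_gt0.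
have MA : (d'.+1 * t = M + A)%N by rewrite subnK // (leq_trans _ At) // leq_pmull.
have AM : (A <= M)%N by move: At; rewrite MA mul2n -addnn leq_add2r.
have tM : (t <= 2 * M)%N.
  by apply: (@leq_trans (M + A)); rewrite -?MA ?leq_pmull // MA mul2n -addnn leq_add2l.
(* After multiplication by [M], the bound is [(M + A) t (t + G)]; [A <= M] and [t <= 2 M] absorb the
   cross terms. *)
rewrite -(leq_pmul2l (leq_trans A0 AM)).
apply: (@leq_trans (d'.+1 * t * (t * (t + G)))).
  rewrite mulnCA; apply: leq_trans (leq_mul (leqnn _) le2) _.
  by apply: eq_leq; ring.
have h1 : (A * t * t <= A * t * (2 * M))%N by rewrite leq_mul2l tM orbT.
have h2 : (A * (t * G) <= M * (t * G))%N by rewrite leq_mul2r AM orbT.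
rewrite MA; move: h1 h2; clear; move: A M; nia.
Qed.

End StepanovCount.

(** * The bound for a pair of monic polynomials *)

Lemma dvdp_subX (K : fieldType) (P A B : {poly K}) n :
  P %| A - B -> P %| A ^+ n - B ^+ n.
Proof. by move=> H; rewrite subrXX dvdp_mulr. Qed.

Lemma dvdp_subM (K : fieldType) (P A B A' B' : {poly K}) :
  P %| A - B -> P %| A' - B' -> P %| A * A' - B * B'.
Proof.
move=> H H'; have -> : A * A' - B * B' = (A - B) * A' + B * (A' - B') by ring.
by apply: dvdp_add; [apply: dvdp_mulr | apply: dvdp_mull].
Qed.

(** Stepanov's method bounds the counts only from above. As their total is known, summing this
    right-hand side still controls the sum of the absolute values. *)
Lemma norm_centered (R : numDomainType) (x y : R) : x \is Num.real -> 0 <= y -> x <= y ->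
  `|x| <= 2 * y - x.
Proof.
move=> xr y0 xy; rewrite real_ler_norml //; apply/andP; split.
  by rewrite opprB lerBlDr lerDl mulr_ge0.
by rewrite lerBrDr -mulr2n mulr_natl lerMn2r xy orbT.
Qed.

Section CharacterSum.
Variables (K : finFieldType) (theta : faithful_character K).
Variables (L : fieldType) (iota : {rmorphism K -> L}).
Variables (nf nF : nat) (Cf : 'M[K]_nf.+1) (CF : 'M[K]_nF.+1) (a b delta d : nat).
Local Notation q := #|K|.
Let f := char_poly Cf.
Let F := char_poly CF.
Let g := f ^+ a * F ^+ b.
Hypotheses (a0 : (0 < a)%N) (b0 : (0 < b)%N) (d1 : (1 < d)%N).
Hypothesis dE : (d * delta)%N = q.-1.
Hypothesis gmult :
  forall e, (0 < e < d)%N -> exists x, ~~ (d %| e * mup x (map_poly iota g))%N.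

(** Up to sign, each determinant is the resultant of [h] with a characteristic polynomial. The
    factor [delta] in the exponents brings the order of the character down to [d]. *)
Definition nu (h : {poly K}) : K :=
  \det (horner_mx Cf h) ^+ (delta * a) * \det (horner_mx CF h) ^+ (delta * b).

Definition psi (h : {poly K}) : algC := theta (nu h).

Lemma nu1 : nu 1 = 1.
Proof. by rewrite /nu !rmorph1 !det1 !expr1n mulr1. Qed.

Lemma nuM : {morph nu : x y / x * y}.
Proof. by move=> x y; rewrite /nu !rmorphM !det_mulmx !exprMn mulrACA. Qed.

Lemma psi_1 : psi 1 = 1. Proof. by rewrite /psi nu1 char1. Qed.

Lemma psi_M : {morph psi : x y / x * y}.
Proof. by move=> x y; rewrite /psi nuM charM. Qed.

Let f_monic : f \is monic. Proof. exact: char_poly_monic. Qed.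
Let F_monic : F \is monic. Proof. exact: char_poly_monic. Qed.
Let g_monic : g \is monic. Proof. by rewrite monicMl ?monic_exp. Qed.
Let g0 : g != 0. Proof. exact: monic_neq0. Qed.
Let G := (size g).-1.
Let sg : (size g <= G.+1)%N. Proof. by rewrite prednK // size_poly_gt0. Qed.
Let d0 : (0 < d)%N. Proof. exact: ltnW. Qed.

Let delta0 : (0 < delta)%N.
Proof.
have : (0 < q.-1)%N by have := finNzRing_gt1 K; case: q => [|[]].
by rewrite -dE muln_gt0 => /andP[].
Qed.

Let cc k := (delta * \sum_(i < k) q ^ i)%N.

Lemma mul_d_cc k : ((d * cc k).+1 = q ^ k)%N.
Proof.
rewrite mulnA dE -predn_exp prednK // expn_gt0 ltnW //; exact: finNzRing_gt1.
Qed.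

Lemma nu_residue mu e (v : 'rV[K]_e) : irr v -> (e %| mu + mu)%N ->
  mpol v %| g ^+ cc (mu + mu) - (nu (mpol v) ^+ ((mu + mu) %/ e))%:P.
Proof.
move=> vi ek; have vP := irrP _ vi; have vm := mpol_monic v.
have Ek : (e * ((mu + mu) %/ e) = mu + mu)%N by rewrite mulnC divnK.
(* The extension degree [mu + mu] is even, so the signs of the reciprocity disappear. *)
have sgn n : (-1) ^+ ((mu + mu) * n) = 1 :> K.
  by rewrite addnn -muln2 -mulnA mulnCA exprM sqrrN expr1n expr1n.
have := residue_norm Cf ((mu + mu) %/ e) vP vm; have := residue_norm CF ((mu + mu) %/ e) vP vm.
rewrite size_mpol /= Ek !sgn !mul1r -/f -/F => HF Hf.
rewrite /g /nu exprMn [in X in _ - X]exprMn polyCM; apply: dvdp_subM.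
  rewrite -[f ^+ a ^+ _]exprM (_ : (a * _ = (\sum_(i < mu + mu) q ^ i) * (delta * a))%N).
    rewrite exprM [X in _ - X%:P]exprAC polyC_exp; exact: dvdp_subX.
  by rewrite /cc; ring.
rewrite -[F ^+ b ^+ _]exprM (_ : (b * _ = (\sum_(i < mu + mu) q ^ i) * (delta * b))%N).
  rewrite exprM [X in _ - X%:P]exprAC polyC_exp; exact: dvdp_subX.
by rewrite /cc; ring.
Qed.

Lemma nu_point mu e (v : 'rV[K]_e) z : irr v -> (e %| mu + mu)%N ->
  (mpol v %| g ^+ cc (mu + mu) - z%:P) = (nu (mpol v) ^+ ((mu + mu) %/ e) == z).
Proof.
move=> vi ek; have H := nu_residue vi ek; apply/idP/eqP => [Hz|<- //].
have : mpol v %| (z - nu (mpol v) ^+ ((mu + mu) %/ e))%:P.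
  rewrite polyCB; set y := (nu _ ^+ _)%:P in H *.
  have -> : z%:P - y = (g ^+ cc (mu + mu) - y) - (g ^+ cc (mu + mu) - z%:P) by ring.
  exact: dvdp_sub.
have [/eqP|ne] := eqVneq (z - nu (mpol v) ^+ ((mu + mu) %/ e)) 0.
  by rewrite subr_eq0 => /eqP.
move/dvdp_leq; rewrite polyC_eq0 ne size_mpol size_polyC ne ltnS leqNgt (irr_deg_gt0 vi).
by move/(_ isT).
Qed.

Local Notation N mu z := (point_count g (mu + mu) (cc (mu + mu)) z).

Lemma sum_over_points mu (phi : K -> algC) :
  \sum_(1 <= e < (mu + mu).+1 | (e %| mu + mu)%N) \sum_(v : 'rV[K]_e | irr v)
     e%:R * phi (nu (mpol v) ^+ ((mu + mu) %/ e)) =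
  \sum_z phi z * (N mu z)%:R.
Proof.
under [RHS]eq_bigr do rewrite /point_count natr_sum mulr_sumr.
rewrite exchange_big /=; apply: eq_bigr => e ek.
under [RHS]eq_bigr do rewrite natr_sum mulr_sumr big_mkcondr.
rewrite exchange_big /=; apply: eq_bigr => v vi.
under [RHS]eq_bigr do rewrite nu_point //.
rewrite -big_mkcond /= (big_pred1 (nu (mpol v) ^+ ((mu + mu) %/ e))).
  by rewrite mulrC.
by move=> z; rewrite eq_sym.
Qed.

Lemma Lpsum_psi mu : Lpsum psi (mu + mu) = \sum_z theta z * (N mu z)%:R.
Proof.
rewrite -sum_over_points; apply: eq_bigr => e ek; apply: eq_bigr => v vi.
by rewrite /psi charX.
Qed.

Lemma total_points mu : (0 < mu)%N -> (\sum_z N mu z = q ^ (mu + mu))%N.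
Proof.
move=> mu0; apply/eqP; rewrite -(eqr_nat algC) natr_sum; apply/eqP.
rewrite -(Lpsum_trivial K algC) ?addn_gt0 ?mu0 //.
transitivity (\sum_z 1 * (N mu z)%:R : algC); first by apply: eq_bigr => z _; rewrite mul1r.
rewrite -(sum_over_points mu (fun=> 1)); apply: eq_bigr => e ek; apply: eq_bigr => v vi.
by rewrite expr1n.
Qed.

Lemma N0_le mu : (N mu 0%R <= G)%N.
Proof.
have H : (1 * N mu 0%R < size g)%N.
  apply: (sum_deg_le (c := fun p => p %| g ^+ cc (mu + mu) - 0%:P)) => // e v ek vi.
  rewrite subr0 expr1; have vP := irrP _ vi.
  elim: (cc _) => [|n IH].
    by rewrite expr0 dvdp1 size_mpol eqSS gtn_eqF ?(irr_deg_gt0 vi).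
  rewrite exprS => H; apply/negPn/negP => ng.
  have cg : coprimep (mpol v) g by rewrite irreducible_poly_coprime.
  by move: H; rewrite Gauss_dvdpr // => /IH vg; rewrite vg in ng.
by rewrite -ltnS (leq_trans _ sg) // -[N mu 0%R]mul1n.
Qed.

(** The values of [nu] are [delta]-th powers, and [d * delta = q - 1]. *)
Lemma N_support mu z : (0 < mu)%N -> (0 < N mu z)%N -> z != 0 -> z ^+ d == 1.
Proof.
move=> mu0 Nz z0; apply: contraTeq Nz => zd; rewrite -leqNgt leqn0.
apply/eqP; rewrite /point_count big1 // => e ek; rewrite big_pred0 // => v.
apply/negbTE/negP => /andP[vi]; rewrite nu_point // => /eqP Ez.
case/eqP: zd; rewrite -Ez exprAC; set y := nu _.
have y0 : y != 0.
  apply: contraNneq z0 => y0; rewrite -Ez -/y y0 expr0n.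
  by rewrite gtn_eqF ?eqxx // divn_gt0 ?(irr_deg_gt0 vi) // dvdn_leq // addn_gt0 mu0.
have -> : y ^+ d = 1; last by rewrite expr1n eqxx.
pose w := \det (horner_mx Cf (mpol v)) ^+ a * \det (horner_mx CF (mpol v)) ^+ b.
have yw : y = w ^+ delta.
  by rewrite exprMn -!exprM [(a * _)%N]mulnC [(b * _)%N]mulnC.
rewrite yw -exprM mulnC dE finField_expf_card1 //; apply: contraNneq y0 => w0.
by rewrite yw w0 expr0n gtn_eqF // delta0.
Qed.

(** Since [theta] sums to zero over the [d]-th roots of unity, [d * S_k] is the sum of the
    [theta z * (d N(z) - q^k)]. Stepanov's bound controls each bracket from above, and the total
    number of points controls their sum from below. *)
Lemma Lpsum_bound mu (t := (q ^ mu)%N) : (0 < mu)%N ->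
    (4 * d * (1 + d * G) <= t)%N ->
  `|Lpsum psi (mu + mu)| <= (2 * (2 * (2 * d * d * (1 + d * G) + G)) + G)%:R * t%:R.
Proof.
move=> mu0 tbig; set C := (2 * (2 * d * d * (1 + d * G) + G))%N.
have EQ : (q ^ (mu + mu) = t * t)%N by rewrite expnD.
have dcc : ((d * cc (mu + mu)).+1 = t * t)%N by rewrite mul_d_cc EQ.
have t0 : (0 < t)%N by rewrite expn_gt0 ltnW // finNzRing_gt1.
pose U := [pred z : K | z ^+ d == 1].
have U0 z : z \in U -> z != 0.
  rewrite inE => /eqP zd; apply: contra_eq_neq zd => ->.
  by rewrite expr0n gtn_eqF // eq_sym oner_eq0.
have NU (phi : K -> algC) : \sum_z phi z * (N mu z)%:R =
    phi 0 * (N mu 0%R)%:R + \sum_(z in U) phi z * (N mu z)%:R.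
  rewrite (bigD1 0) //=; congr (_ + _); rewrite [RHS]big_mkcond /= big_mkcond /=.
  apply: eq_bigr => z _; case: (boolP (z \in U)) => [/U0 -> //|zU].
  case: eqVneq => //= z0; case: (posnP (N mu z)) => [-> |Nz]; first by rewrite mulr0.
  by rewrite inE (N_support mu0 Nz z0) in zU.
have dS : d%:R * Lpsum psi (mu + mu) =
    \sum_(z in U) theta z * (d%:R * (N mu z)%:R - (t * t)%:R).
  rewrite Lpsum_psi NU char0 mul0r add0r.
  under [RHS]eq_bigr do rewrite mulrBr mulrCA.
  rewrite big_split /= -mulr_sumr sumrN -mulr_suml sum_char_roots_of_unity //.
    by rewrite mul0r subr0.
  by rewrite -dE dvdn_mulr.
have tot : \sum_(z in U) (N mu z)%:R = (t * t)%:R - (N mu 0%R)%:R :> algC.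
  have := NU (fun=> 1); under eq_bigr do rewrite mul1r.
  under [X in _ = _ + X]eq_bigr do rewrite mul1r.
  by rewrite mul1r -natr_sum total_points // EQ => ->; rewrite addrC addKr.
have bnd z : z \in U -> `|theta z * (d%:R * (N mu z)%:R - (t * t)%:R)| <=
    2 * (C * t)%:R - (d%:R * (N mu z)%:R - (t * t)%:R).
  move=> zU; rewrite normrM norm_char ?U0 // mul1r.
  apply: norm_centered; rewrite ?ler0n //.
    by rewrite -natrM realB // realn.
  rewrite lerBlDl -natrM -natrD ler_nat.
  exact: (stepanov_count g0 sg d0 gmult dcc tbig (U0 _ zU)).
have d0R : 0 < d%:R :> algC by rewrite ltr0n.
rewrite -(ler_pM2l d0R) -[X in X * `|_|]ger0_norm ?ler0n // -normrM dS.
apply: le_trans (ler_norm_sum _ _ _) _; apply: le_trans (ler_sum _ bnd) _.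
rewrite sumrB sumr_const sumrB -mulr_sumr tot sumr_const.
set u := #|_|; have ud : (u <= d)%N by apply: card_roots_of_unity.
have -> : (2 * (C * t)%:R) *+ u - (d%:R * ((t * t)%:R - (N mu 0%R)%:R) - (t * t)%:R *+ u)
  = (u * (2 * (C * t)) + d * N mu 0%R + u * (t * t))%:R - (d * (t * t))%:R :> algC.
  by rewrite -[(2 * _) *+ u]mulr_natl -[(t * t)%:R *+ u]mulr_natl !natrD !natrM; ring.
rewrite lerBlDr -!natrM -natrD ler_nat.
have := N0_le mu; move: (N mu 0%R) => N0 hN.
have h1 : (u * (2 * (C * t)) <= d * (2 * (C * t)))%N by rewrite leq_mul2r ud orbT.
have h2 : (u * (t * t) <= d * (t * t))%N by rewrite leq_mul2r ud orbT.
have h3 : (d * N0 <= d * (G * t))%N.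
  by rewrite leq_mul2l (leq_trans hN) ?orbT // leq_pmulr.
rewrite mulnDl mulnDr -mulnA; move: h1 h2 h3; clear; lia.
Qed.

(** If every [psi P] were [0] or [1], [S_k] would count all points but those with [z = 0] and be of
    size about [q^k], against the bound of order [q^(k/2)]. *)
Lemma nontrivial_prime : exists e (v : 'rV[K]_e), irr v /\ psi (mpol v) \notin [:: 0; 1].
Proof.
pose C := (2 * (2 * (2 * d * d * (1 + d * G) + G)) + G)%N.
pose mu := (C + G + 4 * d * (1 + d * G)).+1.
have tmu : (mu < q ^ mu)%N by rewrite ltn_expl // finNzRing_gt1.
have bound := @Lpsum_bound mu isT (leq_trans (leq_trans (leq_addl _ _) (leqnSn _)) (ltnW tmu)).
case: (boolP [exists e : 'I_(mu + mu).+1, [exists v : 'rV[K]_e,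
          irr v && (psi (mpol v) \notin [:: 0; 1])]]).
  by case/existsP => e /existsP[v /andP[vi vn]]; exists e, v.
move=> none; exfalso.
have all01 e (v : 'rV[K]_e) : (0 < mu + mu)%N -> (e %| mu + mu)%N -> irr v ->
    theta (nu (mpol v) ^+ ((mu + mu) %/ e)) = (nu (mpol v) ^+ ((mu + mu) %/ e) != 0)%:R.
  move=> mm0 ek vi; have em : (e < (mu + mu).+1)%N by rewrite ltnS dvdn_leq.
  have : psi (mpol v) \in [:: 0; 1].
    apply: contraR none => vn; apply/existsP; exists (Ordinal em); apply/existsP.
    by exists v; rewrite vi.
  rewrite !inE char_eq0 => /orP[/eqP-> | /eqP/char_inj->].
    by rewrite expr0n gtn_eqF ?divn_gt0 ?(irr_deg_gt0 vi) ?eqxx ?char0 // dvdn_leq.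
  by rewrite expr1n oner_eq0 char1.
have E : Lpsum psi (mu + mu) = (q ^ mu * q ^ mu - N mu 0%R)%:R.
  transitivity (\sum_z (z != 0)%:R * (N mu z)%:R : algC).
    rewrite -(sum_over_points mu (fun z => (z != 0)%:R)).
    apply: eq_bigr => e ek; apply: eq_bigr => v vi.
    by rewrite /psi -charX all01.
  rewrite -expnD -total_points // [X in (X - _)%N](bigD1 0) //= addKn natr_sum.
  rewrite (bigD1 0) //= eqxx mul0r add0r; apply: eq_bigr => z z0.
  by rewrite z0 mul1r.
move: bound; rewrite E normr_nat -natrM ler_nat leq_subLR.
apply/negP; rewrite -ltnNge.
have N0G := N0_le mu.
have h : (mu * q ^ mu <= q ^ mu * q ^ mu)%N by rewrite leq_mul2r (ltnW tmu) orbT.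
apply: leq_trans h; rewrite -/C.
have h2 : (N mu 0%R < (G + 1) * q ^ mu)%N.
  rewrite mulnDl mul1n -addn1 leq_add ?(leq_trans N0G) //.
    by rewrite leq_pmulr // (leq_trans _ tmu).
  by rewrite (leq_trans _ tmu).
have h3 : ((C + G + 1) * q ^ mu <= mu * q ^ mu)%N.
  by rewrite leq_mul2r /mu addn1 ltnS leq_addr orbT.
apply: leq_trans h3; move: h2; move: (q ^ mu)%N (N mu 0%R) => x y; clear; nia.
Qed.

Lemma psi_neq0_ndvd e (v : 'rV[K]_e) : irr v -> psi (mpol v) != 0 -> ~~ (mpol v %| g).
Proof.
move=> vi; apply: contraNN => vg; rewrite char_eq0.
have e0 := irr_deg_gt0 vi; have ek : (e %| e + e)%N by rewrite dvdn_addr.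
have : mpol v %| g ^+ cc (e + e) - 0%:P.
  rewrite subr0 dvdp_exp //; have := mul_d_cc (e + e).
  case: (cc _) => // E; have := ltn_expl (e + e) (finNzRing_gt1 K).
  by rewrite -E muln0 ltnS leqn0 addn_eq0 gtn_eqF.
by rewrite nu_point // expf_eq0 => /andP[].
Qed.

Section Modulus.
Variable M0 : {poly K}.
Hypotheses (fM : f %| M0) (FM : F %| M0) (Mf : M0 %| f * F).

Lemma psi_mod (h h' : {poly K}) : M0 %| h - h' -> psi h = psi h'.
Proof.
move=> H; have eqC n (C : 'M[K]_n.+1) : char_poly C %| M0 -> horner_mx C h = horner_mx C h'.
  move=> CM; apply/eqP; rewrite -subr_eq0 -rmorphB.
  have /dvdpP[r ->] := dvdp_trans CM H.
  by rewrite rmorphM /= Cayley_Hamilton mulr0.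
by rewrite /psi /nu !eqC.
Qed.

(** Multiplying residues modulo [M0] by a prime [u], with [psi u] neither [0] nor [1], permutes the
    monic polynomials of degree [m]; hence [A_m = psi(u) A_m]. *)
Lemma Lcoef_psi_eq0 m : ((size M0).-1 <= m)%N -> Lcoef psi m = 0.
Proof.
move=> sM; have [e [u [ui]]] := nontrivial_prime.
rewrite !inE negb_or => /andP[u0 u1]; have uP := irrP _ ui.
have M00 : M0 != 0.
  by apply: contraTneq Mf => ->; rewrite dvd0p mulf_neq0 // monic_neq0.
have cuM : coprimep M0 (mpol u).
  rewrite coprimep_sym irreducible_poly_coprime //; apply/negP => uM.
  have := dvdp_trans uM Mf; apply/negP.
  have := psi_neq0_ndvd ui u0; apply: contraNN => ufF.
  have [uf|uf] := boolP (mpol u %| f); first by rewrite dvdp_mulr // dvdp_exp.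
  rewrite dvdp_mull // dvdp_exp //.
  by move: ufF; rewrite Gauss_dvdpr // irreducible_poly_coprime.
(* Adding [w v] changes only the remainder modulo [M0], into that of the product with [mpol u]; the
   result stays monic of degree [m]. *)
pose w (v : 'rV[K]_m) := (mpol u * mpol v) %% M0 - mpol v %% M0.
have sw v : (size (w v) <= m)%N.
  rewrite -ltnS; apply: (@leq_trans (size M0)); last first.
    by rewrite -[size M0]prednK ?size_poly_gt0 // ltnS.
  rewrite (leq_ltn_trans (size_polyD _ _)) // size_polyN gtn_max.
  by rewrite !ltn_modp M00.
pose phi (v : 'rV[K]_m) : 'rV[K]_m := poly_rV (mpol v + w v).
have phiE v : mpol (phi v) = mpol v + w v.
  rewrite poly_rVK_monic //.
    by rewrite monicE lead_coefDl ?size_mpol ?ltnS // (monicP (mpol_monic v)).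
  by rewrite size_polyDl size_mpol // ltnS.
have phi_mod v : M0 %| mpol (phi v) - mpol u * mpol v.
  rewrite phiE /w.
  have -> : mpol v + ((mpol u * mpol v) %% M0 - mpol v %% M0) - mpol u * mpol v
    = (mpol v - mpol v %% M0) - (mpol u * mpol v - (mpol u * mpol v) %% M0) by ring.
  have H (p : {poly K}) : M0 %| p - p %% M0.
    by rewrite {1}(divp_eq p M0) addrK dvdp_mull.
  by rewrite dvdp_sub.
have phi_inj : injective phi.
  move=> v1 v2 E; have M12 : M0 %| mpol v1 - mpol v2.
    rewrite -(Gauss_dvdpr _ cuM) mulrBr.
    have -> : mpol u * mpol v1 - mpol u * mpol v2 =
       (mpol (phi v2) - mpol u * mpol v2) - (mpol (phi v1) - mpol u * mpol v1).
      by rewrite E; ring.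
    by rewrite dvdp_sub.
  have mod12 (p1 p2 : {poly K}) : M0 %| p1 - p2 -> p1 %% M0 = p2 %% M0.
    by rewrite /dvdp modpD modpN subr_eq0 => /eqP.
  apply: mpol_inj; apply: (addIr (w v1)); rewrite -phiE E phiE; congr (_ + _).
  rewrite /w (mod12 _ _ M12); congr (_ - _); apply/esym/mod12.
  by rewrite -mulrBr dvdp_mull.
have : Lcoef psi m = psi (mpol u) * Lcoef psi m.
  rewrite {1}/Lcoef (reindex_inj phi_inj) mulr_sumr; apply: eq_bigr => v _.
  by rewrite (psi_mod (phi_mod v)) psi_M.
move/eqP; rewrite -subr_eq0 -{1}[Lcoef psi m]mul1r -mulrBl mulf_eq0.
by rewrite subr_eq0 eq_sym (negbTE u1) => /eqP.
Qed.

Lemma weil_Lpsum D : (size M0 <= D.+2)%N -> `|Lpsum psi 1| <= D%:R * sqrtC q%:R.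
Proof.
move=> sM; have A0 m : (D < m)%N -> Lcoef psi m = 0.
  by move=> Dm; apply: Lcoef_psi_eq0; apply: leq_trans Dm; case: (size M0) sM.
have [ws sws wsE] := Lpsum_roots psi_1 psi_M A0.
set s := sqrtC _.
have q0 : 0 < q%:R :> algC by rewrite ltr0n ltnW // finNzRing_gt1.
have wsq w : w \in ws -> `|w| <= s.
  move=> wws; have : `|w ^+ 2| <= q%:R.
    (* The power sums are bounded for even exponents only, so the growth argument is applied to the
       squares of the inverse roots, with ratio [q]. *)
    pose ws2 := [seq w ^+ 2 | w <- ws].
    apply: (@power_sums_bound _ ws2 _ (2 * (2 * (2 * d * d * (1 + d * G) + G)) + G)%:R
             (4 * d * (1 + d * G)).+1) => // [mu mubig|]; last exact: map_f.
    have mu0 : (0 < mu)%N by apply: leq_trans mubig.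
    have := Lpsum_bound mu0; rewrite wsE ?addn_gt0 ?mu0 // normrN natrX.
    rewrite /ws2 big_map; under [X in `|X|]eq_bigr do rewrite addnn -muln2 mulnC exprM.
    apply; apply: leq_trans (ltnW mubig) _; apply: ltnW; apply: ltn_expl.
    exact: finNzRing_gt1.
  rewrite normrX -[q%:R]sqrtCK ler_sqr //; rewrite nnegrE ?sqrtC_ge0 ?ler0n //.
rewrite wsE // normrN; apply: le_trans (ler_norm_sum _ _ _) _.
under eq_bigr do rewrite expr1.
rewrite big_seq; apply: le_trans (ler_sum _ wsq) _.
rewrite -big_seq big_const_seq count_predT iter_addr_0 -[_ *+ _]mulr_natl.
by rewrite ler_wpM2r ?sqrtC_ge0 ?ler0n // ler_nat.
Qed.

End Modulus.

(** The primes of degree one are the [X - x], where the determinants are the values of [f] and [F]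
    up to sign; the signs contribute a constant of modulus one. *)
Lemma Lpsum_psi1 :
  `|Lpsum psi 1| = `|\sum_x theta (f.[x] ^+ (delta * a) * F.[x] ^+ (delta * b))|.
Proof.
rewrite /Lpsum big_mkcond big_nat1 /= /prime_power_sum.
have X1 (x : K) : mpol (const_mx (- x) : 'rV_1) = 'X - x%:P.
  congr (_ + _); apply/polyP => i; rewrite coefN coefC coef_rVpoly.
  case: insubP => [j _ <-|]; first by rewrite mxE ord1.
  by case: i => [|i] //= _; rewrite oppr0.
rewrite (reindex (fun x : K => const_mx (- x) : 'rV[K]_1)) /=; last first.
  exists (fun v : 'rV_1 => - v 0 0) => [x _|v _]; first by rewrite mxE opprK.
  by apply/rowP => i; rewrite mxE opprK ord1.
pose c : K := ((-1) ^+ nf.+1) ^+ (delta * a) * ((-1) ^+ nF.+1) ^+ (delta * b).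
have c0 : c != 0 by rewrite mulf_neq0 // !expf_neq0 // oppr_eq0 oner_eq0.
transitivity `|theta c * \sum_x theta (f.[x] ^+ (delta * a) * F.[x] ^+ (delta * b))|; last first.
  by rewrite normrM norm_char // mul1r.
congr `|_|; rewrite mulr_sumr; apply: eq_big => [x|x _].
  by apply/irrP; rewrite X1; apply: irredp_XsubC.
by rewrite divn1 expr1 mul1r X1 /psi /nu !det_horner_XsubC -charM !exprMn mulrACA.
Qed.

Lemma weil_bound_monic M0 D : f %| M0 -> F %| M0 -> M0 %| f * F -> (size M0 <= D.+2)%N ->
  `|\sum_x theta (f.[x] ^+ (delta * a) * F.[x] ^+ (delta * b))| <= D%:R * sqrtC q%:R.
Proof. by move=> fM FM Mf sM; rewrite -Lpsum_psi1; apply: weil_Lpsum sM. Qed.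

End CharacterSum.

(** * The bound for square-free polynomials *)

Section SquareFree.
Variable K : finFieldType.
Implicit Types p s : {poly K}.

Lemma irreducible_monic_factor s : (1 < size s)%N ->
  exists P, [/\ irreducible_poly P, P \is monic & P %| s].
Proof.
case Es : (size s) => [|[|m]] // _.
have [e [v [vi vs]]] := irreducible_factor Es.
by exists (mpol v); split; [apply/irrP | apply: mpol_monic |].
Qed.

(** An irreducible common factor [P] of [p = t P] and its derivative divides [t P'], hence [t] since
    [P] is separable, so [P^2] divides [p]. *)
Lemma sqfree_coprime_deriv p : sqfree_poly p -> coprimep p p^`().
Proof.
move=> [p0 psq]; apply/negPn/negP; rewrite /coprimep => ncp.
have g0 : gcdp p p^`() != 0 by rewrite gcdp_eq0 negb_and p0.
have [|P [Pirr Pmon Pg]] := @irreducible_monic_factor (gcdp p p^`()).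
  by rewrite ltn_neqAle eq_sym ncp size_poly_gt0.
have /dvdpP[t Ep] := dvdp_trans Pg (dvdp_gcdl _ _).
have := dvdp_trans Pg (dvdp_gcdr _ _).
rewrite Ep derivM (dvdp_addr _ (dvdp_mull _ (dvdpp P))).
rewrite Gauss_dvdpl ?irreducible_coprime_deriv // => Pt.
have := psq P; rewrite Ep dvdp_mul // => /(_ isT).
by case: Pirr => + _; rewrite ltnNge => /negbTE->.
Qed.

(** The witness is the least common multiple [p * (s / gcd p s)]; an irreducible [P] whose square
    divides it would have its square dividing [p] or [s]. *)
Lemma sqfree_lcm p s : sqfree_poly p -> sqfree_poly s ->
  exists m, [/\ sqfree_poly m, p %| m, s %| m & m %| p * s].
Proof.
move=> [p0 psq] [s0 ssq]; pose h := gcdp p s.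
have h0 : h != 0 by rewrite gcdp_eq0 negb_and p0.
have /dvdpP[s1 Es] : h %| s := dvdp_gcdr _ _.
have s10 : s1 != 0 by apply: contraNneq s0 => z; rewrite Es z mul0r.
exists (p * s1); split.
- split; first by rewrite mulf_neq0.
  move=> w ww; rewrite leqNgt; apply/negP => /irreducible_monic_factor[P [Pirr Pmon Pw]].
  have {ww}PP : P * P %| p * s1 := dvdp_trans (dvdp_mul Pw Pw) ww.
  have absurd1 u : (forall g, g * g %| u -> (size g <= 1)%N) -> P * P %| u -> False.
    by move=> usq /usq; case: Pirr => + _; rewrite ltnNge => /negbTE->.
  have Ps : s1 %| s by rewrite Es dvdp_mulr.
  have [Pp|nPp] := boolP (P %| p); have [Ps1|nPs1] := boolP (P %| s1).
  + apply: (absurd1 s ssq); rewrite Es dvdp_mul // dvdp_gcd Pp.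
    exact: dvdp_trans Ps.
  + apply: (absurd1 p psq); move: PP; rewrite Gauss_dvdpl //.
    by rewrite coprimepMl irreducible_poly_coprime // nPs1.
  + apply: (absurd1 s ssq); apply: dvdp_trans Ps; move: PP; rewrite Gauss_dvdpr //.
    by rewrite coprimepMl irreducible_poly_coprime // nPp.
  + have : P %| p * s1 by apply: dvdp_trans PP; rewrite dvdp_mulr.
    by rewrite Gauss_dvdpr ?(negbTE nPs1) // irreducible_poly_coprime.
- by rewrite dvdp_mulr.
- by rewrite {1}Es mulrC dvdp_mul // dvdp_gcdl.
- by rewrite dvdp_mul2l // Es dvdp_mulr.
Qed.

End SquareFree.

Section SplitRoots.
Variables (K : finFieldType) (L : fieldType) (iota : {rmorphism K -> L}).
Implicit Types p : {poly K}.

Lemma sqfree_split_roots p (rs : seq L) :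
    sqfree_poly p -> map_poly iota p %| \prod_(z <- rs) ('X - z%:P) ->
  exists2 s : seq L, uniq s & map_poly iota p = iota (lead_coef p) *: \prod_(z <- s) ('X - z%:P).
Proof.
move=> psq /dvdp_prod_XsubC[m]; set s := mask m rs => ps.
have lp0 : iota (lead_coef p) != 0 by rewrite fmorph_eq0 lead_coef_eq0; case: psq.
have E : map_poly iota p = iota (lead_coef p) *: \prod_(z <- s) ('X - z%:P).
  have /eqpP[[c1 c2] /= /andP[c10 c20] Ec] := ps.
  have := congr1 lead_coef Ec; rewrite !lead_coefZ lead_coef_map.
  rewrite (monicP (monic_prod_XsubC _ _ _)) mulr1 => Ecc.
  apply: (scalerI c10); rewrite Ec scalerA Ecc //.
exists s => //; rewrite -separable_prod_XsubC.
have := sqfree_coprime_deriv psq.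
rewrite -(coprimep_map iota) -deriv_map E derivZ coprimepZl // coprimepZr //.
by rewrite separable_poly.unlock.
Qed.

End SplitRoots.

Lemma mup_prod_uniq (L : fieldType) (s : seq L) x : uniq s ->
  mup x (\prod_(z <- s) ('X - z%:P)) = (x \in s).
Proof. by move=> us; rewrite mu_prod_XsubC count_uniq_mem. Qed.

(* Some root of [f F] is a root of only one of the two polynomials; it isolates one exponent,
   and any root of the other polynomial then controls the other exponent. *)
Lemma coprime_exponents (L : eqType) (s1 s2 : seq L) a b d e :
    (0 < size s1)%N -> (0 < size s2)%N -> ~ s1 =i s2 ->
    coprime (gcdn a b) d -> (0 < e < d)%N ->
  exists x, ~~ (d %| e * (a * (x \in s1) + b * (x \in s2)))%N.
Proof.
move=> n1 n2 ne cop /andP[e0 ed].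
have nd : ~ ((d %| e * a)%N /\ (d %| e * b)%N).
  move=> [da db]; have : (d %| e * gcdn a b)%N by rewrite muln_gcdr dvdn_gcd da.
  by rewrite Gauss_dvdl ?[coprime d _]coprime_sym // => /(dvdn_leq e0); rewrite leqNgt ed.
have [x [y [xs1 ys2 xy]]] : exists x y, [/\ x \in s1, y \in s2 &
    (x \notin s2) || (y \notin s1)].
  case: s1 s2 n1 n2 ne => [|x1 s1] [|x2 s2] // _ _ ne.
  have [all1|/allPn[x xs1 xn]] := boolP (all (mem (x2 :: s2)) (x1 :: s1)); last first.
    by exists x, x2; rewrite xs1 mem_head /= xn.
  have [all2|/allPn[y ys2 yn]] := boolP (all (mem (x1 :: s1)) (x2 :: s2)); last first.
    by exists x1, y; rewrite ys2 mem_head /= yn orbT.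
  by case: ne => z; apply/idP/idP => [/(allP all1)|/(allP all2)].
have [dx|] := boolP (d %| e * (a * (x \in s1) + b * (x \in s2)))%N; last by exists x.
have [dy|] := boolP (d %| e * (a * (y \in s1) + b * (y \in s2)))%N; last by exists y.
case: nd; move: dx dy; rewrite xs1 ys2 !muln1.
case/orP: xy => /negbTE ->; rewrite ?muln0 ?addn0 ?add0n.
  move=> da; rewrite mulnDr; case: (y \in s1); rewrite ?muln1 ?muln0 ?add0n //.
  by rewrite dvdn_addr.
by move=> + db; rewrite mulnDr; case: (x \in s2); rewrite ?muln1 ?muln0 ?addn0 // dvdn_addl.
Qed.

Section WeilBound.
Variables (K : finFieldType) (theta : faithful_character K).
Variables (L : fieldType) (iota : {rmorphism K -> L}).
Variables (f F : {poly K}) (rs r : seq L) (D : nat).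
Local Notation q := #|K|.
Hypotheses (sf : (1 < size f)%N) (sF : (1 < size F)%N).
Hypotheses (fsq : sqfree_poly f) (Fsq : sqfree_poly F) (nfF : ~ exists c, f = c *: F).
Hypothesis split_fF : map_poly iota (f * F) %= \prod_(z <- rs) ('X - z%:P).
Hypothesis r_roots : forall x, root (map_poly iota (f * F)) x -> x \in r.
Hypothesis r_size : size r = D.+1.

Let f0 : f != 0. Proof. by case: fsq. Qed.
Let F0 : F != 0. Proof. by case: Fsq. Qed.
Let f1 := (lead_coef f)^-1 *: f.
Let F1 := (lead_coef F)^-1 *: F.
Let lf0 : (lead_coef f)^-1 != 0. Proof. by rewrite invr_eq0 lead_coef_eq0. Qed.
Let lF0 : (lead_coef F)^-1 != 0. Proof. by rewrite invr_eq0 lead_coef_eq0. Qed.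

Let split_dvd (p : {poly K}) : p %| f * F -> sqfree_poly p ->
  exists2 s : seq L, uniq s & map_poly iota p = iota (lead_coef p) *: \prod_(z <- s) ('X - z%:P).
Proof.
move=> pfF psq; apply: (sqfree_split_roots psq (rs := rs)).
by rewrite -(eqp_dvdr _ split_fF) dvdp_map.
Qed.

(** The least common multiple has simple roots, all of them in [r], which bounds its degree by
    [D + 1]. *)
Lemma sqfree_modulus : exists M0 : {poly K},
  [/\ f1 %| M0, F1 %| M0, M0 %| f1 * F1 & (size M0 <= D.+2)%N].
Proof.
have [M0 [msq fM FM Mf]] := sqfree_lcm fsq Fsq; exists M0; split.
- by rewrite dvdpZl.
- by rewrite dvdpZl.
- by rewrite -scalerAl -scalerAr !dvdpZr.
have [s us Es] := split_dvd Mf msq.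
have lM0 : iota (lead_coef M0) != 0 by rewrite fmorph_eq0 lead_coef_eq0; case: msq.
rewrite -(size_map_poly iota) Es size_scale // size_prod_XsubC ltnS -r_size.
apply: uniq_leq_size => // x xs; apply: r_roots.
have : map_poly iota M0 %| map_poly iota (f * F) by rewrite dvdp_map.
move/dvdpP=> [t ->]; rewrite rootM; apply/orP; right.
by rewrite Es rootZ // root_prod_XsubC.
Qed.

Lemma power_product_multiplicity a b d e :
    coprime (gcdn a b) d -> (0 < e < d)%N ->
  exists x, ~~ (d %| e * mup x (map_poly iota (f1 ^+ a * F1 ^+ b)))%N.
Proof.
move=> cop ed.
have split1 (p : {poly K}) : p %| f * F -> sqfree_poly p -> (1 < size p)%N ->
    exists s : seq L, [/\ uniq s, (0 < size s)%N &
      map_poly iota ((lead_coef p)^-1 *: p) = \prod_(z <- s) ('X - z%:P)].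
  move=> pfF psq sp; have [s us Es] := split_dvd pfF psq.
  have lp0 : lead_coef p != 0 by rewrite lead_coef_eq0; case: psq.
  exists s; split=> //.
    move: sp; rewrite -(size_map_poly iota) Es size_scale ?fmorph_eq0 //.
    by rewrite size_prod_XsubC.
  by rewrite map_polyZ Es scalerA /= fmorphV mulVf ?scale1r // fmorph_eq0.
have [s1 [us1 n1 E1]] := split1 f (dvdp_mulr _ (dvdpp f)) fsq sf.
have [s2 [us2 n2 E2]] := split1 F (dvdp_mull _ (dvdpp F)) Fsq sF.
have ne : ~ s1 =i s2.
  move=> eqs; apply: nfF; exists (lead_coef f / lead_coef F).
  have : map_poly iota f1 = map_poly iota F1.
    rewrite E1 E2; apply: perm_big; exact: uniq_perm.
  move/(map_poly_inj iota) => EfF.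
  by rewrite -scalerA -/F1 -EfF /f1 scalerA mulfV ?scale1r // lead_coef_eq0.
have [x xP] := coprime_exponents n1 n2 ne cop ed; exists x.
have p1 : \prod_(z <- s1) ('X - z%:P) != 0 by rewrite monic_neq0 // monic_prod_XsubC.
have p2 : \prod_(z <- s2) ('X - z%:P) != 0 by rewrite monic_neq0 // monic_prod_XsubC.
rewrite rmorphM !rmorphXn /= E1 E2 mupM ?expf_neq0 // !mup_exp //.
by rewrite !mup_prod_uniq.
Qed.

Lemma weil_bound A B : (0 < A)%N -> (0 < B)%N -> ~~ ((q.-1 %| A) && (q.-1 %| B))%N ->
  `|\sum_x theta (f.[x] ^+ A * F.[x] ^+ B)| <= D%:R * sqrtC q%:R.
Proof.
move=> A0 B0 nAB.
have q1 : (0 < q.-1)%N by have := finNzRing_gt1 K; case: q => [|[]].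
(* Taking out the whole common divisor makes [gcdn a b] coprime to the order [d]; the non-triviality
   of the pair of exponents gives [d > 1]. *)
pose delta := gcdn (gcdn A B) q.-1.
have delta0 : (0 < delta)%N by rewrite gcdn_gt0 q1 orbT.
have [a EA] : exists a, A = (delta * a)%N.
  by have /dvdnP[a ->] := dvdn_trans (dvdn_gcdl _ _ : delta %| _)%N (dvdn_gcdl _ _);
     exists a; rewrite mulnC.
have [b EB] : exists b, B = (delta * b)%N.
  by have /dvdnP[b ->] := dvdn_trans (dvdn_gcdl _ _ : delta %| _)%N (dvdn_gcdr _ _);
     exists b; rewrite mulnC.
have [d Ed] : exists d, (d * delta)%N = q.-1.
  by have /dvdnP[d ->] := (dvdn_gcdr _ _ : delta %| _)%N; exists d.
have a0 : (0 < a)%N by move: A0; rewrite EA muln_gt0 => /andP[].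
have b0 : (0 < b)%N by move: B0; rewrite EB muln_gt0 => /andP[].
have cop : coprime (gcdn a b) d.
  rewrite /coprime -(eqn_pmul2l delta0) muln1 muln_gcdr muln_gcdr -EA -EB.
  by rewrite mulnC Ed.
have d1 : (1 < d)%N.
  rewrite ltn_neqAle; apply/andP; split; last first.
    by move: q1; rewrite -Ed muln_gt0 => /andP[].
  apply: contraNneq nAB => d1; rewrite -Ed -d1 mul1n EA EB.
  by rewrite !dvdn_mulr.
have f1m : f1 \is monic by rewrite monicE lead_coefZ mulVf // lead_coef_eq0.
have F1m : F1 \is monic by rewrite monicE lead_coefZ mulVf // lead_coef_eq0.
have [M0 [fM FM Mf sM]] := sqfree_modulus.
have szf : size f1 = (size f - 2).+2 by rewrite size_scale //; case: (size f) sf => [|[|n]] //= _; rewrite !subSS subn0.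
have szF : size F1 = (size F - 2).+2 by rewrite size_scale //; case: (size F) sF => [|[|n]] //= _; rewrite !subSS subn0.
have [Cf Ef] := companion_ex f1m szf.
have [CF EF] := companion_ex F1m szF.
have gm e : (0 < e < d)%N ->
    exists x, ~~ (d %| e * mup x (map_poly iota (char_poly Cf ^+ a * char_poly CF ^+ b)))%N.
  by rewrite Ef EF; apply: power_product_multiplicity.
rewrite -Ef -EF in fM FM Mf.
have := @weil_bound_monic K theta L iota _ _ Cf CF a b delta d a0 b0 d1 Ed gm M0 D fM FM Mf sM.
rewrite Ef EF -EA -EB; apply: le_trans.
pose c := (lead_coef f) ^+ A * (lead_coef F) ^+ B.
have c0 : c != 0 by rewrite mulf_neq0 // expf_neq0 // lead_coef_eq0.
have -> : \sum_x theta (f.[x] ^+ A * F.[x] ^+ B) =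
    theta c * \sum_x theta (f1.[x] ^+ A * F1.[x] ^+ B).
  rewrite mulr_sumr; apply: eq_bigr => x _; rewrite -charM mulrACA -!exprMn !hornerZ.
  by rewrite !mulrA !mulfV ?lead_coef_eq0 // !mul1r.
by rewrite normrM norm_char // mul1r.
Qed.

End WeilBound.

(** * Characteristic functions of partially primitive elements *)

Lemma sum_pow_root_of_unity (R : idomainType) (y : R) n : y ^+ n = 1 ->
  \sum_(i < n) y ^+ i = if y == 1 then n%:R else 0.
Proof.
move=> yn; case: eqP => [->|/eqP y1].
  by under eq_bigr do rewrite expr1n; rewrite sumr_const card_ord.
have : (y - 1) * \sum_(i < n) y ^+ i = 0.
  by rewrite -subrX1 yn subrr.
by move/eqP; rewrite mulf_eq0 subr_eq0 (negbTE y1) => /eqP.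
Qed.

Section Decomposition.
Variables (K : finFieldType) (theta : faithful_character K).
Local Notation q := #|K|.
Local Notation wchar := (algC * nat)%type.

(** A list of pairs encodes a linear combination of powers of [theta]; the trivial character with
    coefficient one is kept apart. *)
Definition ev (l : seq wchar) (x : K) : algC := \sum_(t <- l) t.1 * theta x ^+ t.2.

Definition weight (l : seq wchar) : algC := \sum_(t <- l) `|t.1|.

Definition primitive_at n (s : seq nat) (x : K) : bool :=
  [&& x != 0, x ^+ (q.-1 %/ n) == 1 & all (fun p => x ^+ (q.-1 %/ n %/ p) != 1) s].

(** For distinct primes dividing [(q - 1) / n], this is the proportion of [K^*] selected by
    [primitive_at]. It is generic in [T] because it occurs over [rat], [algC] and a real closed
    field. *)
Definition kap (T : fieldType) n (s : seq nat) : T :=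
  n%:R^-1 * \prod_(p <- s) (1 - p%:R^-1).

Lemma ev_cat l1 l2 x : ev (l1 ++ l2) x = ev l1 x + ev l2 x.
Proof. exact: big_cat. Qed.

Lemma weight_cat l1 l2 : weight (l1 ++ l2) = weight l1 + weight l2.
Proof. exact: big_cat. Qed.

Lemma weight_ge0 l : 0 <= weight l.
Proof. by apply: sumr_ge0 => t _. Qed.

(* If [p] does not divide [S], the second condition keeps [t.2 + j (q - 1) / (n p)] non-zero modulo
   [q - 1] for [n %| S] and [0 < j < p]: adding the prime [p] creates no trivial character. *)
Definition nontrivial_mod (S : nat) (l : seq wchar) : Prop :=
  forall t, t \in l -> ~~ (q.-1 %| t.2)%N /\ (q.-1 %| t.2 * S)%N.

Definition decomposes n s l : Prop :=
  [/\ nontrivial_mod (n * \prod_(p <- s) p) l,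
      weight l + 1 <= (n * 2 ^ size s)%:R &
      forall x, x != 0 -> (primitive_at n s x)%:R = kap algC n s * (1 + ev l x)].

Let q1 : (0 < q.-1)%N. Proof. by have := finNzRing_gt1 K; case: q => [|[]]. Qed.

(** The indicator of [x^m = 1] is the average of the [n] characters [theta^(i m)]. *)
Lemma decomposes_nil n : (n %| q.-1)%N -> exists l, decomposes n [::] l.
Proof.
move=> nq; set m := (q.-1 %/ n)%N; have Eq : (m * n)%N = q.-1 by rewrite divnK.
have [m0 n0] : (0 < m)%N /\ (0 < n)%N by move: q1; rewrite -Eq muln_gt0 => /andP.
exists [seq ((1 : algC), (i * m)%N) | i <- index_iota 1 n]; split.
- move=> t /mapP[i]; rewrite mem_index_iota => /andP[i0 iN] -> /=; split.
    rewrite -Eq [(i * m)%N]mulnC dvdn_pmul2l //; apply/negP => /(dvdn_leq i0).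
    by rewrite leqNgt iN.
  by rewrite big_nil muln1 -mulnA Eq dvdn_mull.
- rewrite /weight big_map /= sumr_const_nat normr1 muln1.
  by rewrite natr1 -addn1 subnK.
move=> x x0; rewrite /primitive_at x0 /= andbT /kap big_nil mulr1.
have yn : theta (x ^+ m) ^+ n = 1.
  by rewrite -charX -exprM Eq finField_expf_card1 ?char1.
have := sum_pow_root_of_unity yn.
have -> : (theta (x ^+ m) == 1) = (x ^+ m == 1).
  by apply/eqP/eqP => [/char_inj //|->]; rewrite char1.
rewrite -(big_mkord xpredT (fun i => theta (x ^+ m) ^+ i)) big_ltn // expr0 => Es.
rewrite /ev big_map (eq_bigr (fun i => theta (x ^+ m) ^+ i)); last first.
  by move=> i _ /=; rewrite mul1r mulnC exprM charX.
rewrite Es; case: eqP => _; last by rewrite mulr0.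
by rewrite mulVf // pnatr_eq0 -lt0n.
Qed.

(** When [x^m = 1], the value [y = theta (x^(m/p))] is a [p]-th root of unity, and the indicator of
    [y <> 1] is [(1 - 1/p) (1 - (y + ... + y^(p-1)) / (p - 1))]. The list [l'] collects the new
    terms; their weight equals that of the old ones, the trivial one included. *)
Lemma decomposes_step n s l p : (n %| q.-1)%N -> prime p -> (p %| q.-1 %/ n)%N ->
    ~~ (p %| \prod_(r <- s) r)%N -> decomposes n s l ->
  exists l', [/\ (forall t, t \in l' -> ~~ (q.-1 %| t.2)%N),
     weight l' <= (n * 2 ^ size s)%:R,
     decomposes n (p :: s) (l ++ l') &
     forall x, x != 0 ->
       (primitive_at n (p :: s) x)%:R = kap algC n (p :: s) * (1 + ev l x + ev l' x)].
Proof.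
move=> nq pp pm nps [lnt lwt lE].
set m := (q.-1 %/ n)%N in pm; have Eq : (m * n)%N = q.-1 by rewrite divnK.
have Em : ((m %/ p) * p)%N = m by rewrite divnK.
have mn0 : (0 < m * n)%N by rewrite Eq.
have mpn0 : (0 < m %/ p * n)%N by move: mn0; rewrite -{1}Em -mulnA mulnCA muln_gt0 => /andP[].
have p1 := prime_gt1 pp.
have pR0 : p.-1%:R != 0 :> algC by rewrite pnatr_eq0 -lt0n -ltnS prednK // ltnW.
pose l' := [seq (- p.-1%:R^-1 * t.1, (t.2 + j * (m %/ p))%N) |
    j <- index_iota 1 p, t <- (1, 0%N) :: l].
have wl' : weight l' = 1 + weight l.
  rewrite /weight big_allpairs_dep /=.
  under eq_bigr => j _ do under eq_bigr => t _ do rewrite normrM normrN normfV normr_nat.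
  under eq_bigr => j _ do rewrite -mulr_sumr big_cons normr1.
  by rewrite sumr_const_nat subn1 -mulrnAl -[_^-1 *+ _]mulr_natl mulfV // mul1r.
have nt' t : t \in l' -> ~~ (q.-1 %| t.2)%N /\ (q.-1 %| t.2 * (n * \prod_(r <- p :: s) r))%N.
  case/allpairsP => -[j u] /= [+ ul ->] /=; rewrite mem_index_iota => /andP[j0 jp].
  have uS : (q.-1 %| u.2 * (n * \prod_(r <- s) r))%N.
    by move: ul; rewrite inE => /orP[/eqP->|/lnt[]]; rewrite ?mul0n ?dvdn0.
  split.
    apply: contra nps => dv.
    (* The extra factor removes [u.2] modulo [q - 1]; what remains would force [p] to divide [j] or
       the product over [s]. *)
    have : (q.-1 %| (u.2 + j * (m %/ p)) * (n * \prod_(r <- s) r))%N by apply: dvdn_mulr.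
    rewrite mulnDl dvdn_addr // -Eq -{1}Em.
    have -> : (j * (m %/ p) * (n * \prod_(r <- s) r) = (m %/ p * n) * (j * \prod_(r <- s) r))%N by ring.
    rewrite -mulnA [(p * n)%N]mulnC mulnA dvdn_pmul2l // Euclid_dvdM // => /orP[|//].
    by move/(dvdn_leq j0); rewrite leqNgt jp.
  rewrite big_cons mulnDl dvdn_add //.
    by rewrite [(n * _)%N]mulnCA mulnCA dvdn_mull.
  have -> : (j * (m %/ p) * (n * (p * \prod_(r <- s) r)) =
     (m %/ p * p * n) * (j * \prod_(r <- s) r))%N by ring.
  by rewrite Em Eq dvdn_mulr.
have evE x : x != 0 -> (primitive_at n (p :: s) x)%:R = kap algC n (p :: s) * (1 + ev l x + ev l' x).
  move=> x0.
  have -> : (primitive_at n (p :: s) x)%:R =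
     (primitive_at n s x)%:R * (x ^+ (m %/ p) != 1)%:R :> algC.
    rewrite -natrM mulnb; congr (nat_of_bool _)%:R; rewrite /primitive_at -/m /=.
    by case: (x == 0); case: (x ^+ m == 1); case: (x ^+ (m %/ p) == 1); rewrite /= ?andbF ?andbT.
  pose y := theta (x ^+ (m %/ p)).
  pose X := 1 - p.-1%:R^-1 * \sum_(1 <= j < p) y ^+ j.
  have El' : ev l' x = - p.-1%:R^-1 * (\sum_(1 <= j < p) y ^+ j) * (1 + ev l x).
    rewrite /ev big_allpairs_dep /= mulr_sumr mulr_suml; apply: eq_bigr => j _.
    have -> : 1 + ev l x = \sum_(t <- (1, 0%N) :: l) t.1 * theta x ^+ t.2.
      by rewrite big_cons expr0 mul1r.
    rewrite mulr_sumr; apply: eq_bigr => t _ /=.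
    have -> : theta x ^+ (t.2 + j * (m %/ p)) = theta x ^+ t.2 * y ^+ j.
      by rewrite exprD [(j * _)%N]mulnC exprM /y charX.
    by ring.
  have -> : kap algC n (p :: s) * (1 + ev l x + ev l' x) =
     (primitive_at n s x)%:R * ((1 - p%:R^-1) * X).
    by rewrite (lE x x0) El' /kap big_cons /X; ring.
  have [pr|npr] := boolP (primitive_at n s x); last by rewrite !mul0r.
  rewrite !mul1r.
  have yp : y ^+ p = 1.
    by rewrite -charX -exprM Em; have /and3P[_ /eqP-> _] := pr; rewrite char1.
  have := sum_pow_root_of_unity yp.
  have -> : (y == 1) = (x ^+ (m %/ p) == 1).
    by apply/eqP/eqP => [/char_inj //|xp]; rewrite /y xp char1.
  rewrite -(big_mkord xpredT (fun i => y ^+ i)) big_ltn ?prime_gt0 // expr0 /X.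
  have pE : p%:R = p.-1%:R + 1 :> algC by rewrite natr1 prednK // prime_gt0.
  have pn0 : p.-1%:R + 1 != 0 :> algC by rewrite -pE pnatr_eq0 -lt0n prime_gt0.
  rewrite pE; move: (\sum_(_ <= _ < _) _) => Y.
  case: eqP => _ EY /=.
    have -> : Y = p.-1%:R by apply: (addrI 1); rewrite EY addrC.
    by rewrite mulVf // subrr mulr0.
  have -> : Y = -1 by apply/eqP; rewrite -addr_eq0 addrC EY.
  by field; rewrite pn0 pR0.
exists l'; split=> //; first by move=> t /nt'[].
  by rewrite wl' addrC.
split; last by move=> x x0; rewrite evE // ev_cat addrA.
  move=> t; rewrite mem_cat => /orP[tl|/nt' //]; have [h1 h2] := lnt t tl; split=> //.
  by rewrite big_cons [(n * _)%N]mulnCA mulnCA dvdn_mull.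
rewrite weight_cat wl' [size _]/= expnS mulnCA mul2n -addnn natrD.
have -> : weight l + (1 + weight l) + 1 = (weight l + 1) + (weight l + 1) by ring.
exact: lerD.
Qed.

End Decomposition.

(** * Counting partially primitive pairs *)

Lemma kap_gt0 (T : numFieldType) n s : (0 < n)%N -> all prime s -> 0 < kap T n s.
Proof.
move=> n0 /allP sp; rewrite mulr_gt0 ?invr_gt0 ?ltr0n // big_seq.
apply: prodr_gt0 => p /sp pp.
by rewrite subr_gt0 invf_lt1 ?ltr0n ?ltr1n ?prime_gt1 ?prime_gt0.
Qed.

Lemma ratr_kap (T : numFieldType) n s : ratr (kap rat n s) = kap T n s.
Proof.
rewrite /kap rmorphM fmorphV rmorph_nat rmorph_prod; congr (_ * _).
by apply: eq_bigr => p _; rewrite rmorphB rmorph1 fmorphV rmorph_nat.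
Qed.

(** The character estimates live in [algC], the theorem in an arbitrary real closed field. The
    quantity being rational, the bound passes from one to the other through its square. *)
Lemma ratr_sqrt_transfer (R : rcfType) (x : rat) (w c : nat) :
  `|ratr x : algC| <= w%:R * sqrtC c%:R -> `|ratr x : R| <= w%:R * Num.sqrt c%:R.
Proof.
move=> H; have x2 : x ^+ 2 <= (w ^ 2 * c)%:R.
  rewrite -(ler_rat algC) rmorphXn /= ratr_nat -real_normK.
    rewrite natrM natrX -(sqrtCK c%:R) -exprMn ler_sqr ?nnegrE //.
    by rewrite mulr_ge0 ?sqrtC_ge0 ?ler0n.
  exact: Creal_Crat (Crat_rat _).
rewrite -sqrtr_sqr -[w%:R]ger0_norm ?ler0n // -sqrtr_sqr -sqrtrM ?exprn_ge0 ?ler0n //.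
by rewrite ler_wsqrtr // -rmorphXn -natrX -natrM -[X in _ <= X]ratr_nat ler_rat.
Qed.

Section Counting.
Variables (K : finFieldType) (theta : faithful_character K) (f F : {poly K}) (D : nat).
Local Notation q := #|K|.
Local Notation wchar := (algC * nat)%type.
Hypothesis weil : forall A B, (0 < A)%N -> (0 < B)%N -> ~~ ((q.-1 %| A) && (q.-1 %| B))%N ->
  `|\sum_x theta (f.[x] ^+ A * F.[x] ^+ B)| <= D%:R * sqrtC q%:R.

Definition count_primitive n s N s' : nat :=
  \sum_x (primitive_at n s f.[x] && primitive_at N s' F.[x]).

Definition nonzeros : nat := \sum_x ((f.[x] != 0)%R && (F.[x] != 0)%R).

Definition bilinear (l l' : seq wchar) : algC :=
  \sum_x ((f.[x] != 0) && (F.[x] != 0))%:R * (ev theta l f.[x] * ev theta l' F.[x]).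

Local Notation E := (D%:R * sqrtC q%:R : algC).
Local Notation one := (1 : algC, 0%N).

Let E0 : 0 <= E. Proof. by rewrite mulr_ge0 ?ler0n ?sqrtC_ge0 ?ler0n. Qed.

Let q1 : (0 < q.-1)%N. Proof. by have := finNzRing_gt1 K; case: q => [|[]]. Qed.

(** Adding [q - 1] to both exponents makes them positive, changes nothing at non-zero values, and
    kills the points where [f] or [F] vanishes. *)
Lemma twisted_sum_le a b : ~~ ((q.-1 %| a) && (q.-1 %| b))%N ->
  `|\sum_x ((f.[x] != 0) && (F.[x] != 0))%:R * (theta f.[x] ^+ a * theta F.[x] ^+ b)| <= E.
Proof.
move=> nab; have := @weil (a + q.-1) (b + q.-1).
rewrite !addn_gt0 q1 !orbT !dvdn_addl // => /(_ isT isT nab).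
apply: le_trans; rewrite le_eqVlt; apply/orP; left; apply/eqP; congr `|_|.
apply: eq_bigr => x _; rewrite charM !charX !exprD.
have [->|fx] := eqVneq f.[x] 0.
  by rewrite char0 mul0r [0 ^+ q.-1]expr0n gtn_eqF // !(mulr0, mul0r).
have [->|Fx] := eqVneq F.[x] 0.
  by rewrite char0 mul0r [0 ^+ q.-1]expr0n gtn_eqF // !(mulr0, mul0r).
by rewrite mul1r !char_pow_card // !mulr1.
Qed.

Lemma bilinear_le l l' :
    (forall t t', t \in l -> t' \in l' -> ~~ ((q.-1 %| t.2) && (q.-1 %| t'.2))%N) ->
  `|bilinear l l'| <= weight l * weight l' * E.
Proof.
move=> nt; have -> : bilinear l l' = \sum_(t <- l) \sum_(t' <- l') t.1 * t'.1 *
   \sum_x ((f.[x] != 0) && (F.[x] != 0))%:R * (theta f.[x] ^+ t.2 * theta F.[x] ^+ t'.2).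
  under [RHS]eq_bigr do under eq_bigr do rewrite mulr_sumr.
  under [RHS]eq_bigr do rewrite exchange_big.
  rewrite [RHS]exchange_big; apply: eq_bigr => x _ /=.
  rewrite /ev big_distrlr /= mulr_sumr; apply: eq_bigr => t _.
  by rewrite mulr_sumr; apply: eq_bigr => t' _; ring.
rewrite /weight big_distrlr /= mulr_suml; apply: le_trans (ler_norm_sum _ _ _) _.
rewrite big_seq [X in _ <= X]big_seq; apply: ler_sum => t tl.
rewrite mulr_suml; apply: le_trans (ler_norm_sum _ _ _) _.
rewrite big_seq [X in _ <= X]big_seq; apply: ler_sum => t' tl'.
rewrite !normrM ler_wpM2l ?mulr_ge0 //.
by apply: twisted_sum_le; apply: nt.
Qed.

Lemma ev_one l x : ev theta (one :: l) x = 1 + ev theta l x.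
Proof. by rewrite /ev big_cons expr0 mulr1. Qed.

Lemma weight_one l : weight (one :: l) = 1 + weight l.
Proof. by rewrite /weight big_cons normr1. Qed.

Lemma bilinear_cat l1 l2 l' : bilinear (l1 ++ l2) l' = bilinear l1 l' + bilinear l2 l'.
Proof.
by rewrite -big_split; apply: eq_bigr => x _; rewrite ev_cat mulrDl mulrDr.
Qed.

Lemma bilinear_one_one : bilinear [:: one] [:: one] = nonzeros%:R.
Proof.
by rewrite natr_sum; apply: eq_bigr => x _; rewrite !ev_one /ev !big_nil addr0 !mulr1.
Qed.

Lemma bilinear_one_cons l' : bilinear [:: one] (one :: l') = nonzeros%:R + bilinear [:: one] l'.
Proof.
rewrite -bilinear_one_one -big_split; apply: eq_bigr => x _ /=.
by rewrite !ev_one /ev !big_nil; ring.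
Qed.

Lemma count_decomposed n s N s' l l' :
    decomposes theta n s l -> decomposes theta N s' l' ->
  (count_primitive n s N s')%:R = kap algC n s * kap algC N s' * bilinear (one :: l) (one :: l').
Proof.
move=> [_ _ H] [_ _ H']; rewrite natr_sum mulr_sumr; apply: eq_bigr => x _.
have [fx|fx] := eqVneq f.[x] 0; first by rewrite /primitive_at fx eqxx mul0r mulr0.
have [Fx|Fx] := eqVneq F.[x] 0.
  by rewrite /primitive_at Fx eqxx andbF mul0r mulr0.
by rewrite -mulnb natrM H // H' // !ev_one /= mul1r; ring.
Qed.

(** Removing the pair of trivial characters leaves a total weight
    [(1 + weight l) (1 + weight l') - 1], all of it on non-trivial pairs. *)
Lemma count_main n s N s' l l' : (0 < n)%N -> (0 < N)%N -> all prime s -> all prime s' ->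
    decomposes theta n s l -> decomposes theta N s' l' ->
  `|(count_primitive n s N s')%:R / (kap algC n s * kap algC N s') - nonzeros%:R| <=
    ((n * 2 ^ size s) * (N * 2 ^ size s') - 1)%:R * E.
Proof.
move=> n0 N0 sp sp' H H'; rewrite (count_decomposed H H').
have k0 : kap algC n s * kap algC N s' != 0.
  by rewrite mulf_neq0 // gt_eqF // kap_gt0.
rewrite mulrAC mulfV // mul1r -cat1s bilinear_cat bilinear_one_cons.
have cancel3 (x y z : algC) : x + y + z - x = y + z by ring.
rewrite cancel3.
have [nt wl _] := H; have [nt' wl' _] := H'.
apply: le_trans (ler_normD _ _) _.
have h1 : `|bilinear [:: one] l'| <= weight l' * E.
  have := @bilinear_le [:: one] l'; rewrite /weight big_seq1 normr1 mul1r; apply.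
  by move=> t t' _ /nt' [h _]; rewrite negb_and h orbT.
have h2 : `|bilinear l (one :: l')| <= weight l * weight (one :: l') * E.
  by apply: bilinear_le => t t' /nt [h _] _; rewrite negb_and h.
apply: le_trans (lerD h1 h2) _; rewrite -mulrDl ler_wpM2r //.
rewrite weight_one.
rewrite natrB ?muln_gt0 ?expn_gt0 ?n0 ?N0 // lerBrDr natrM.
have -> : weight l' + weight l * (1 + weight l') + 1 = (weight l + 1) * (weight l' + 1) by ring.
by rewrite ler_pM // addr_ge0 ?weight_ge0 ?ler01.
Qed.

(** After division by their respective [kap], the two counts share the terms coming from [l]; only
    the non-trivial characters brought in by [p] remain. *)
Lemma count_step n s N s' l l' p : (n %| q.-1)%N -> (0 < N)%N -> all prime s -> all prime s' ->
    decomposes theta n s l -> decomposes theta N s' l' ->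
    prime p -> (p %| q.-1 %/ n)%N -> ~~ (p %| \prod_(r <- s) r)%N ->
  `|(count_primitive n (p :: s) N s')%:R / (kap algC n (p :: s) * kap algC N s')
     - (count_primitive n s N s')%:R / (kap algC n s * kap algC N s')| <=
    ((n * 2 ^ size s) * (N * 2 ^ size s'))%:R * E.
Proof.
move=> nq N0 sp sp' H H' pp pm nps.
have n0 : (0 < n)%N by rewrite (dvdn_gt0 q1).
have [l2 [nt2 wl2 H2 _]] := decomposes_step nq pp pm nps H.
rewrite (count_decomposed H H') (count_decomposed H2 H').
have k0 : kap algC n s * kap algC N s' != 0.
  by rewrite mulf_neq0 // gt_eqF // kap_gt0.
have k1 : kap algC n (p :: s) * kap algC N s' != 0.
  by rewrite mulf_neq0 // gt_eqF // kap_gt0 //= pp.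
rewrite ![_ * _ * bilinear _ _ / _]mulrAC !mulfV // !mul1r.
rewrite -cat_cons bilinear_cat [_ + bilinear l2 _]addrC addrK.
have [_ wl' _] := H'.
have h : `|bilinear l2 (one :: l')| <= weight l2 * weight (one :: l') * E.
  by apply: bilinear_le => t t' /nt2 h _; rewrite negb_and h.
apply: le_trans h _; rewrite ler_wpM2r // natrM.
by rewrite ler_pM ?weight_ge0 // weight_one addrC.
Qed.

End Counting.

(** * The sieve *)

Lemma prime_dvdn_prod (p : nat) (l : seq nat) :
  prime p -> all prime l -> (p %| \prod_(r <- l) r)%N = (p \in l).
Proof.
move=> pp; elim: l => [|r l IH] /=; first by rewrite big_nil dvdn1 gtn_eqF ?prime_gt1.
move=> /andP[rp lp]; rewrite big_cons Euclid_dvdM // IH // in_cons.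
by rewrite dvdn_prime2.
Qed.

Lemma all_prime_primes a : all prime (primes a).
Proof. by apply/allP => p; rewrite mem_primes => /and3P[]. Qed.

Lemma prime_dvdn_nat_rad p a : prime p -> (p %| nat_rad a)%N = (p \in primes a).
Proof. by move=> pp; apply: prime_dvdn_prod; rewrite ?all_prime_primes. Qed.

(** * Square-free divisors as products of subsets of primes *)

Section SquareFreeDivisors.

Fixpoint subset_products (l : seq nat) : seq nat :=
  if l is p :: l' then subset_products l' ++ [seq p * d | d <- subset_products l']%N
  else [:: 1%N].

Lemma size_subset_products l : size (subset_products l) = (2 ^ size l)%N.
Proof.
by elim: l => //= p l IH; rewrite size_cat size_map IH addnn -mul2n -expnS.
Qed.

Lemma subset_products_dvdn l d : d \in subset_products l -> (d %| \prod_(p <- l) p)%N.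
Proof.
elim: l d => [|p l IH] d /=; first by rewrite inE big_nil => /eqP->.
rewrite mem_cat big_cons => /orP[/IH dl|/mapP[e /IH el ->]]; first exact: dvdn_mull.
by rewrite dvdn_mul.
Qed.

Lemma uniq_subset_products l : all prime l -> uniq l -> uniq (subset_products l).
Proof.
elim: l => //= p l IH /andP[pp lp] /andP[pl ul].
rewrite cat_uniq IH //= map_inj_uniq ?IH // => [|x y /eqP]; last first.
  by rewrite eqn_pmul2l ?prime_gt0 // => /eqP.
rewrite andbT; apply/hasPn => _ /mapP[d _ ->]; apply: contra pl => /= /subset_products_dvdn.
by move/(dvdn_trans (dvdn_mulr d (dvdnn p))); rewrite prime_dvdn_prod.
Qed.

Lemma sqfree_nat_subset_products l d : all prime l -> uniq l ->
  d \in subset_products l -> sqfree_nat d.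
Proof.
move=> lp ul /subset_products_dvdn dl.
have l0 : (0 < \prod_(p <- l) p)%N.
  by rewrite big_seq prodn_cond_gt0 // => p /(allP lp); apply: prime_gt0.
apply/andP; split; first exact: dvdn_gt0 dl.
apply/allP => p; rewrite mem_primes => /and3P[pp _ pd]; apply/negP => ppd.
have pl : p \in l by rewrite -prime_dvdn_prod // (dvdn_trans pd).
have := dvdn_trans ppd dl; rewrite (big_rem p pl) /= dvdn_pmul2l ?prime_gt0 //.
rewrite prime_dvdn_prod // ?mem_rem_uniq ?inE ?eqxx //.
by apply/allP => r /mem_rem; apply: allP lp r.
Qed.

Lemma W_ge_exp a : (0 < a)%N -> (2 ^ size (primes a) <= W a)%N.
Proof.
move=> a0; rewrite -size_subset_products /W -size_filter.
have up := primes_uniq a; have pp := all_prime_primes a.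
apply: uniq_leq_size; first exact: uniq_subset_products.
move=> d dl; rewrite mem_filter (sqfree_nat_subset_products pp up dl) -dvdn_divisors //.
apply: dvdn_trans (subset_products_dvdn dl) _.
rewrite [X in (_ %| X)%N](prod_prime_decomp a0) prime_decompE big_map /=.
rewrite big_seq [X in (_ %| X)%N]big_seq.
apply: (big_ind2 (fun x y => x %| y)%N) => // [x1 x2 y1 y2|p pa]; first exact: dvdn_mul.
by rewrite dvdn_exp // logn_gt0.
Qed.

End SquareFreeDivisors.

Lemma decomposes_exists (K : finFieldType) (theta : faithful_character K) n s :
    (n %| #|K|.-1)%N -> all prime s -> uniq s ->
    all (fun p => p %| #|K|.-1 %/ n)%N s ->
  exists l, decomposes theta n s l.
Proof.
move=> nq; elim: s => [|p s IH] /=; first by move=> *; apply: decomposes_nil.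
move=> /andP[pp sp] /andP[ps us] /andP[pm sm].
have [l Hl] := IH sp us sm.
have nps : ~~ (p %| \prod_(r <- s) r)%N by rewrite prime_dvdn_prod.
by have [l' [_ _ H _]] := decomposes_step nq pp pm nps Hl; exists (l ++ l').
Qed.

Lemma primitive_at_cat (K : finFieldType) n s1 s2 (x : K) :
  primitive_at n (s1 ++ s2) x =
  primitive_at n s2 x && all (fun p => x ^+ (#|K|.-1 %/ n %/ p) != 1) s1.
Proof.
by rewrite /primitive_at all_cat -!andbA; congr andb; congr andb; rewrite andbC.
Qed.

(** If the order [k] of [x] were a proper divisor of [m], a prime [p] dividing [m / k] would give
    [x^(m/p) = 1]. *)
Lemma primitive_at_primes (K : finFieldType) n s (x : K) : (n %| #|K|.-1)%N ->
    {subset primes (#|K|.-1 %/ n) <= s} -> primitive_at n s x -> n_primitive n x.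
Proof.
move=> nq sub /and3P[x0 /eqP xm /allP H]; split=> //.
set m := (#|K|.-1 %/ n)%N in sub xm H *.
have q1 : (0 < #|K|.-1)%N by have := finNzRing_gt1 K; case: #|K| => [|[]].
have m0 : (0 < m)%N.
  by move: q1; rewrite -(divnK nq) -/m muln_gt0 => /andP[].
have [k kp km] := prim_order_exists m0 xm.
have k0 := prim_order_gt0 kp.
case: (eqVneq k m) => [<- //|ne].
have mk : (1 < m %/ k)%N.
  rewrite ltn_neqAle divn_gt0 // dvdn_leq // andbT eq_sym; apply: contra ne => /eqP E.
  by rewrite -(divnK km) E mul1n.
pose p := pdiv (m %/ k).
have pp : prime p by apply: pdiv_prime.
have pmk : (p %| m %/ k)%N by apply: pdiv_dvd.
have pm : (p %| m)%N by rewrite (dvdn_trans pmk) // dvdn_div.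
have ps : p \in s by apply: sub; rewrite mem_primes pp m0.
have := H p ps; rewrite -(prim_order_dvd kp) => /negP[].
by rewrite dvdn_divRL // mulnC -dvdn_divRL.
Qed.

Lemma count_primitiveC (K : finFieldType) (f F : {poly K}) n s N s' :
  count_primitive f F n s N s' = count_primitive F f N s' n s.
Proof. by apply: eq_bigr => x _; rewrite andbC. Qed.

(** Checked for each [x] passing the base conditions: if it passes all extra tests both sides agree,
    and otherwise a failed test makes up for the last term on the left. *)
Lemma sieve_inequality (K : finFieldType) (f F : {poly K}) n s N s' ps ls :
  (\sum_(p <- ps) count_primitive f F n (p :: s) N s' +
   \sum_(l <- ls) count_primitive f F n s N (l :: s') + count_primitive f F n s N s' <=
   (size ps + size ls) * count_primitive f F n s N s' +
   count_primitive f F n (ps ++ s) N (ls ++ s'))%N.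
Proof.
rewrite /count_primitive exchange_big /= [X in (_ + X + _)%N]exchange_big /= big_distrr /=.
rewrite -!big_split /=; apply: leq_sum => x _.
rewrite !primitive_at_cat.
under eq_bigr do rewrite -cat1s primitive_at_cat /= andbT.
under [X in (_ + X + _)%N]eq_bigr do rewrite -cat1s primitive_at_cat /= andbT.
case: (primitive_at n s _) => /=; last first.
  by rewrite !big1 // => *; rewrite ?andbF.
case: (primitive_at N s' _) => /=; last first.
  by rewrite !big1 // => *; rewrite ?andbF.
under eq_bigr do rewrite andbT.
rewrite muln1.
have sumc (P : pred nat) l : (\sum_(i <- l) P i = count P l)%N.
  by rewrite -sum1_count [RHS]big_mkcond; apply: eq_bigr => i _; case: (P i).
set P := fun p : nat => _ ^+ _ != 1; set P' := fun p : nat => _ ^+ _ != 1.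
rewrite (sumc P) (sumc P').
rewrite !all_count; have := count_size P ps; have := count_size P' ls.
move: (count P ps) (count P' ls) (size ps) (size ls) => a b u v.
by have [->|] := eqVneq a u; have [->|] := eqVneq b v; rewrite /=; lia.
Qed.

Lemma sum_one_minus (R : numFieldType) (ps : seq nat) :
  \sum_(p <- ps) (1 - p%:R^-1) = (size ps)%:R - \sum_(p <- ps) p%:R^-1 :> R.
Proof. by rewrite sumrB big_const_seq count_predT iter_addr_0. Qed.

(* [c0 * y] is the count for the base sets of primes, [SP] the sum of the counts with one more
   prime, [T] the total weight of the characters involved, [s] is [sqrt q] and [w = u + v]. *)
Lemma sieve_arithmetic (R : realFieldType) (w y c0 tot T D s q Z delta SP : R) :
    0 < y -> 0 < delta -> 0 <= T -> 1 <= D -> 2 <= s -> s * s = q -> q - (D + 1) <= Z ->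
    Z - (T - 1) * (D * s) <= c0 ->
    (w - 1 + delta) * (c0 - T * (D * s)) * y <= SP ->
    SP + c0 * y <= w * (c0 * y) + tot ->
    T * D * ((w - 1) / delta + 2) < s ->
  0 < tot.
Proof.
move=> y0 d0 T0 D1 s2 ssq hZ hc hSP hs hyp.
have hyp2 : T * (D * s) * (w - 1 + 2 * delta) < delta * q.
  have : T * D * ((w - 1) / delta + 2) * (delta * s) < s * (delta * s).
    by rewrite ltr_pM2r // mulr_gt0 //; lra.
  have -> : T * D * ((w - 1) / delta + 2) * (delta * s) = T * (D * s) * (w - 1 + 2 * delta).
    by field; rewrite gt_eqF.
  by have -> : s * (delta * s) = delta * q by rewrite -ssq; ring.
have key : 0 < (delta * c0 - (w - 1 + delta) * (T * (D * s))) * y.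
  rewrite mulr_gt0 //.
  have h1 : delta * (q - (D + 1) - (T - 1) * (D * s)) <= delta * c0.
    by rewrite ler_pM2l //; lra.
  (* From [2 <= s] and [1 <= D] one gets [D + 1 <= D s], which absorbs the loss due to the zeros of
     [f F]. *)
  have Ds : D * 2 <= D * s by rewrite ler_wpM2l //; lra.
  have h2 : 0 <= delta * (D * s - (D + 1)) by apply: mulr_ge0; lra.
  have -> : (w - 1 + delta) * (T * (D * s)) =
    T * (D * s) * (w - 1 + 2 * delta) - delta * (T * (D * s)) by ring.
  lra.
apply: lt_le_trans key _.
have -> : (delta * c0 - (w - 1 + delta) * (T * (D * s))) * y =
  (w - 1 + delta) * (c0 - T * (D * s)) * y + c0 * y - w * (c0 * y) by ring.
lra.
Qed.

(** * Bounds over a real closed field *)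

Section RealBounds.
Variables (R : rcfType) (K : finFieldType) (theta : faithful_character K).
Variables (f F : {poly K}) (D : nat).
Local Notation q := #|K|.
Local Notation E := (D%:R * Num.sqrt q%:R : R).

Definition weil_property (f F : {poly K}) : Prop :=
  forall A B, (0 < A)%N -> (0 < B)%N -> ~~ ((q.-1 %| A) && (q.-1 %| B))%N ->
  `|\sum_x theta (f.[x] ^+ A * F.[x] ^+ B)| <= D%:R * sqrtC q%:R.

Hypothesis weil : weil_property f F.
Variables (n N : nat) (s s' : seq nat).
Hypotheses (nq : (n %| q.-1)%N) (Nq : (N %| q.-1)%N).
Hypotheses (sp : all prime s) (sp' : all prime s') (us : uniq s) (us' : uniq s').
Hypothesis sm : all (fun p => p %| q.-1 %/ n)%N s.
Hypothesis sm' : all (fun p => p %| q.-1 %/ N)%N s'.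
Local Notation T := ((n * 2 ^ size s) * (N * 2 ^ size s'))%N.
Local Notation y := (kap R n s * kap R N s').
Local Notation C0 := (count_primitive f F n s N s').

Let q1 : (0 < q.-1)%N. Proof. by have := finNzRing_gt1 K; case: q => [|[]]. Qed.
Let n0 : (0 < n)%N. Proof. exact: dvdn_gt0 nq. Qed.
Let N0 : (0 < N)%N. Proof. exact: dvdn_gt0 Nq. Qed.

Lemma count_lower_bound : (nonzeros f F)%:R - (T%:R - 1) * E <= C0%:R / y.
Proof.
have [l H] := decomposes_exists theta nq sp us sm.
have [l' H'] := decomposes_exists theta Nq sp' us' sm'.
have := count_main weil n0 N0 sp sp' H H'; rewrite [X in _ <= X]mulrA -natrM.
(* The same rational number is read in [algC], where the estimate holds, and in [R]. *)
pose x : rat := C0%:R / (kap rat n s * kap rat N s') - (nonzeros f F)%:R.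
have xE (T : numFieldType) : ratr x = C0%:R / (kap T n s * kap T N s') - (nonzeros f F)%:R.
  by rewrite rmorphB fmorph_div rmorphM /= !ratr_kap !rmorph_nat.
rewrite -xE => /(ratr_sqrt_transfer R); rewrite xE natrM -mulrA natrB; last first.
  by rewrite !muln_gt0 n0 N0 !expn_gt0.
by rewrite ler_distl => /andP[].
Qed.

Lemma count_step_lower_bound p : prime p -> (p %| q.-1 %/ n)%N -> p \notin s ->
  (1 - p%:R^-1) * ((C0%:R / y - T%:R * E) * y) <= (count_primitive f F n (p :: s) N s')%:R.
Proof.
move=> pp pm ps.
have [l H] := decomposes_exists theta nq sp us sm.
have [l' H'] := decomposes_exists theta Nq sp' us' sm'.
have nps : ~~ (p %| \prod_(r <- s) r)%N by rewrite prime_dvdn_prod.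
have := count_step weil nq N0 sp sp' H H' pp pm nps; rewrite [X in _ <= X]mulrA -natrM.
set Cp := count_primitive _ _ _ (p :: s) _ _.
pose x : rat := Cp%:R / (kap rat n (p :: s) * kap rat N s') - C0%:R / (kap rat n s * kap rat N s').
have xE (T : numFieldType) : ratr x =
    Cp%:R / (kap T n (p :: s) * kap T N s') - C0%:R / (kap T n s * kap T N s').
  have kapE s0 : ratr (kap rat n s0 * kap rat N s') = kap T n s0 * kap T N s'.
    by rewrite rmorphM /= !ratr_kap.
  by rewrite rmorphB !fmorph_div /= !kapE !rmorph_nat.
rewrite -xE => /(ratr_sqrt_transfer R); rewrite xE natrM -mulrA ler_distl => /andP[+ _].
have y1 : 0 < kap R n (p :: s) * kap R N s' by rewrite mulr_gt0 ?kap_gt0 //= pp.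
rewrite ler_pdivlMr //; apply: le_trans; rewrite le_eqVlt; apply/orP; left.
by apply/eqP; rewrite /kap big_cons; ring.
Qed.

End RealBounds.

(** * From the sieve to the theorem *)

Lemma nonzeros_ge (K : finFieldType) (L : fieldType) (iota : {rmorphism K -> L})
    (f F : {poly K}) (r : seq L) :
    (forall x, root (map_poly iota (f * F)) x -> x \in r) ->
  (#|K| <= nonzeros f F + size r)%N.
Proof.
move=> rootsr; pose Zs := [seq x <- enum K | root (f * F) x].
have sZ : (size Zs <= size r)%N.
  rewrite -(size_map iota); apply: uniq_leq_size.
    by rewrite (map_inj_uniq (fmorph_inj iota)) filter_uniq ?enum_uniq.
  move=> _ /mapP[x + ->]; rewrite mem_filter => /andP[rx _].
  by apply: rootsr; rewrite fmorph_root.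
apply: leq_trans (leq_add (leqnn _) sZ).
rewrite size_filter -sum1_count big_enum_cond /= big_mkcond /=.
rewrite /nonzeros -big_split /= -sum1_card; apply: leq_sum => x _.
by rewrite rootM /root; case: eqP; case: eqP.
Qed.

Lemma radical_splitting m k ps :
    (0 < m)%N -> all prime ps -> all (fun p => ~~ (p %| k)%N) ps ->
    nat_rad m = (k * \prod_(p <- ps) p)%N ->
  [/\ (0 < k)%N, all (fun p => p %| m)%N (primes k), all (fun p => p %| m)%N ps,
      all (fun p => p \notin primes k) ps & {subset primes m <= ps ++ primes k}].
Proof.
move=> m0 pp pk E.
have rad0 : (0 < nat_rad m)%N.
  rewrite /nat_rad big_seq prodn_cond_gt0 // => p pm.
  by apply: prime_gt0; apply: (allP (all_prime_primes m)).
have k0 : (0 < k)%N by move: rad0; rewrite E muln_gt0 => /andP[].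
have radm p : prime p -> (p %| nat_rad m)%N -> (p %| m)%N.
  by move=> p_pr; rewrite prime_dvdn_nat_rad // mem_primes => /and3P[].
split=> //.
- apply/allP => p; rewrite mem_primes => /and3P[p_pr _ pd].
  by apply: radm => //; rewrite E dvdn_mulr.
- apply/allP => p pps; have p_pr := allP pp p pps.
  by apply: radm => //; rewrite E dvdn_mull // prime_dvdn_prod.
- by apply/allP => p pps; rewrite mem_primes !negb_and (allP pk p pps) !orbT.
move=> p pm; have p_pr := allP (all_prime_primes m) p pm.
have : (p %| nat_rad m)%N by rewrite prime_dvdn_nat_rad.
rewrite E Euclid_dvdM // prime_dvdn_prod // mem_cat => /orP[pk'|->//].
by rewrite mem_primes p_pr k0 pk' orbT.
Qed.

Theorem theorem4p7
  (K : finFieldType) (n N : nat) (f F : {poly K})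
  (L : splittingFieldType K) (r : seq L) (D : nat)
  (kn kN : nat) (ps ls : seq nat) (R : rcfType) :
  (5 <= #|K|)%N ->
  dvdn n #|K|.-1 -> dvdn N #|K|.-1 ->
  (1 < size f)%N -> (1 < size F)%N ->
  sqfree_poly f -> sqfree_poly F ->
  ~ (exists c : K, f = c *: F) ->
  (* L is the splitting field of f*F over K, r lists its distinct roots *)
  splittingFieldFor 1%VS (map_poly (in_alg L) (f * F)) fullv ->
  uniq r -> (forall x : L, root (map_poly (in_alg L) (f * F)) x = (x \in r)) ->
  size r = D.+1 -> (1 <= D)%N ->
  (* ((q-1)/n)^* = k_n p_1 ... p_u *)
  uniq ps -> all prime ps -> all (fun p => ~~ dvdn p kn) ps ->
  nat_rad (divn #|K|.-1 n) = (kn * \prod_(p <- ps) p)%N ->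
  (* ((q-1)/N)^* = k_N l_1 ... l_v *)
  uniq ls -> all prime ls -> all (fun l => ~~ dvdn l kN) ls ->
  nat_rad (divn #|K|.-1 N) = (kN * \prod_(l <- ls) l)%N ->
  let delta : R := 1 - \sum_(p <- ps) (p%:R)^-1 - \sum_(l <- ls) (l%:R)^-1 in
  0 < delta ->
  D%:R * n%:R * N%:R * (W kn)%:R * (W kN)%:R
    * (((size ps + size ls)%:R - 1) / delta + 2) < Num.sqrt (#|K|%:R) ->
  exists theta : K, n_primitive n f.[theta] /\ n_primitive N F.[theta].
Proof.
move=> q5 nq Nq sf sF fsq Fsq nfF [rs split_rs _] ur rP sr D1.
move=> ups pps nps Eps uls pls nls Els delta d0 hyp.
have q1 : (0 < #|K|.-1)%N by case: #|K| q5 => [|[]].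
have [theta] : inhabited (faithful_character K) by split; apply: faithful_character_exists.
have weil1 : weil_property theta D f F.
  by move=> A B A0 B0 nAB; apply: (weil_bound theta sf sF fsq Fsq nfF split_rs _ sr) => // x; rewrite rP.
(* Exchanging [f] and [F] lets the step estimate serve for the primes [l] as well. *)
have weil2 : weil_property theta D F f.
  move=> A B A0 B0 nAB; under eq_bigr do rewrite mulrC.
  by apply: weil1 => //; rewrite andbC.
have m0 k : (k %| #|K|.-1)%N -> (0 < #|K|.-1 %/ k)%N.
  by move=> kq; move: q1; rewrite -{1}(divnK kq) muln_gt0 => /andP[].
have [kn0 skn sps ndp subn] := radical_splitting (m0 n nq) pps nps Eps.
have [kN0 skN sls ndl subN] := radical_splitting (m0 N Nq) pls nls Els.
set s := primes kn in skn ndp subn; set s' := primes kN in skN ndl subN.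
have sp : all prime s := all_prime_primes kn.
have sp' : all prime s' := all_prime_primes kN.
have us : uniq s := primes_uniq kn.
have us' : uniq s' := primes_uniq kN.
have n0 : (0 < n)%N := dvdn_gt0 q1 nq.
have N0 : (0 < N)%N := dvdn_gt0 q1 Nq.
pose tot := count_primitive f F n (ps ++ s) N (ls ++ s').
suff tot0 : (0 < tot)%N.
  have /existsP[x /andP[fx Fx]] : [exists x, primitive_at n (ps ++ s) f.[x]
                                    && primitive_at N (ls ++ s') F.[x]].
    apply: contraLR tot0 => /existsPn none; rewrite -leqNgt leqn0 /tot.
    by apply/eqP; rewrite /count_primitive big1 // => x _; rewrite (negbTE (none x)).
  exists x; split.
    exact: primitive_at_primes nq subn fx.
  exact: primitive_at_primes Nq subN Fx.
pose y : R := kap R n s * kap R N s'.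
have y0 : 0 < y by rewrite mulr_gt0 ?kap_gt0.
pose T := ((n * 2 ^ size s) * (N * 2 ^ size s'))%N.
pose C0 := count_primitive f F n s N s'.
pose w : R := (size ps + size ls)%:R.
pose sq : R := Num.sqrt #|K|%:R.
pose SP : R := \sum_(p <- ps) (count_primitive f F n (p :: s) N s')%:R
             + \sum_(l <- ls) (count_primitive f F n s N (l :: s'))%:R.
have sumE : w - 1 + delta = \sum_(p <- ps) (1 - p%:R^-1) + \sum_(l <- ls) (1 - l%:R^-1).
  by rewrite !sum_one_minus /w /delta natrD; ring.
rewrite -(ltr0n R).
apply: (@sieve_arithmetic R w y (C0%:R / y) tot%:R T%:R D%:R sq #|K|%:R (nonzeros f F)%:R delta SP) => //.
- by rewrite ler1n.
- rewrite -[2]ger0_norm ?ler0n // -sqrtr_sqr ler_wsqrtr // -natrX ler_nat.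
  exact: ltnW.
- by rewrite -expr2 sqr_sqrtr ?ler0n.
- rewrite lerBlDr natr1 -natrD ler_nat -sr.
  by apply: (@nonzeros_ge K L (in_alg L)) => x; rewrite rP.
- exact: (count_lower_bound R weil1 nq Nq sp sp' us us' skn skN).
- rewrite sumE -mulrA mulrDl !mulr_suml; apply: lerD.
    rewrite big_seq [X in _ <= X]big_seq; apply: ler_sum => p pin.
    have := count_step_lower_bound R weil1 nq Nq sp sp' us us' skn skN.
    by apply; [apply: (allP pps) | apply: (allP sps) | apply: (allP ndp)].
  rewrite big_seq [X in _ <= X]big_seq; apply: ler_sum => l lin.
  have := count_step_lower_bound R weil2 Nq nq sp' sp us' us skN skn.
  move=> /(_ l (allP pls l lin) (allP sls l lin) (allP ndl l lin)).
  rewrite (count_primitiveC F f) [count_primitive F f _ _ _ _]count_primitiveC.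
  by rewrite [kap R N s' * _]mulrC [(N * _ * _)%N]mulnC.
- rewrite /SP /w divfK ?gt_eqF // -!natr_sum -natrM -!natrD ler_nat.
  exact: sieve_inequality.
apply: le_lt_trans hyp.
have TW : T%:R * D%:R <= D%:R * n%:R * N%:R * (W kn)%:R * (W kN)%:R :> R.
  rewrite -!natrM ler_nat /T -/s -/s'.
  have -> : (n * 2 ^ size s * (N * 2 ^ size s') * D =
             D * n * N * 2 ^ size s * 2 ^ size s')%N by ring.
  by rewrite !leq_mul // W_ge_exp.
apply: ler_wpM2r => //.
(* For [u + v = 0] the numerator [u + v - 1] is [-1], but then [delta = 1] and the whole factor
   equals [1]. *)
rewrite /w; have [w0|w0] := posnP (size ps + size ls).
  move: w0 (w0) => /eqP; rewrite addn_eq0 !size_eq0 => /andP[/eqP pn /eqP ln] ->.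
  by rewrite /delta pn ln !big_nil !subr0 divr1; lra.
by rewrite addr_ge0 // divr_ge0 ?(ltW d0) // subr_ge0 ler1n.
Qed.
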